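(* Let $\mathbf Z\in C_{q+1}([0,T])\times D_p(S^1)$ be a solution of the spatially discontinuous space-time finite element method $$\int_0^T\!\!\int_{S^1} K\mathbf Z_t\cdot\phi + L\,\mathcal G(\mathbf Z)\cdot\phi - \nabla S(\mathbf Z)\cdot\phi\; dx\,dt = 0\qquad \forall\phi\in D_q([0,T])\times D_p(S^1),$$ $$\mathbf Z(0,x)=\mathcal P_0\big(\mathbf z(0,x)\big),$$ where $\mathcal P_0$ is the $L_2$ projection into $D_p(S^1)$. For each $n=0,\dots,N-1$ let $\mathcal P$ denote the $L_2$ projection (in space-time, on $I_n\times S^1$) into $D_q(I_n)\times D_p(S^1)$, and define $$W := \nabla S(\mathbf Z)\cdot\mathcal P(\mathcal G(\mathbf Z)),$$ the momentum flux and density $$F^{m}=\tfrac12\mathbf Z_t\cdot K\mathbf Z - S(\mathbf Z),\qquad G^{m}=\tfrac12\mathcal G(\mathbf Z)\cdot K\mathbf Z,$$ and the energy flux and density $$F^{e}=\tfrac12\mathbf Z_t\cdot L\mathbf Z,\qquad G^{e}=\tfrac12\mathcal G(\mathbf Z)\cdot L\mathbf Z + S(\mathbf Z).$$ Then for every $n=0,\dots,N-1$ the following laws hold: $$\int_{I_n}\int_{S^1}(G^{m})_t+\mathcal G\big(F^{m}+S(\mathbf Z)\big)-W\;dx\,dt=0,$$ $$\int_{I_n}\int_{S^1}(G^{e})_t+\mathcal G(F^{e})\;dx\,dt=0.$$ Moreover, locally in space, for every $n=0,\dots,N-1$ and $m=0,\dots,M-1$, $$\int_{I_n}\int_{J_m}(G^{m})_t+\mathcal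 G\big(F^{m}+S(\mathbf Z)\big)-W\;dx\,dt=\int_{I_n}\tfrac12 a_m\big(\mathbf Z_t\cdot K\mathbf Z\big)+\tfrac12 b_m\big(\mathbf Z_t,K\mathbf Z\big)\;dt,$$ $$\int_{I_n}\int_{J_m}(G^{e})_t+\mathcal G(F^{e})\;dx\,dt=\int_{I_n}\tfrac12 a_m\big(\mathbf Z_t\cdot L\mathbf Z\big)+\tfrac12 b_m\big(\mathbf Z_t,L\mathbf Z\big)\;dt.$$ (The superscript $m$ in $F^m,G^m$ stands for ''momentum'' and is unrelated to the element index $m$.)
   Context: Let $T>0$, let $S^1=[0,1)$ be the periodic unit interval, let $D\ge 2$ be an integer, let $K,L\in\mathbb R^{D\times D}$ be constant skew-symmetric matrices, and let $S:\mathbb R^D\to\mathbb R$ be continuously differentiable. The multisymplectic PDE being discretised is $K\mathbf z_t+L\mathbf z_x=\nabla S(\mathbf z)$ for $\mathbf z=\mathbf z(t,x)\in\mathbb R^D$, with initial data $\mathbf z(0,x)$ given in $L_2(S^1)^D$. The dot denotes the Euclidean inner product. Meshes: $0=t_0<t_1<\dots<t_N=T$ with temporal elements $I_n=[t_n,t_{n+1})$, and $0=x_0<x_1<\dots<x_M=1$ with spatial elements $J_m=(x_m,x_{m+1})$, where $x_0$ and $x_M$ are identified by periodicity. Finite element spaces: for a partitioned one-dimensional domain $\Omega$, $D_r(\Omega)$ is the space of $\mathbb R^D$-valued functions whose restriction to each element is a polynomial of degree at most $r$ (in each component), with no continuity imposed between elements, and $C_r(\Omega)=D_r(\Omega)\cap(\mathcal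 C^0(\Omega))^D$. $D_q(I_n)$ is the space of polynomials of degree at most $q$ on the single element $I_n$. The notation $X\times Y$ for a temporal space $X$ and spatial space $Y$ denotes the tensor product finite element space, i.e. $\mathbb R^D$-valued functions of $(t,x)$ each component of which lies in the tensor product of the corresponding scalar temporal and spatial spaces. Here $q,p\ge 0$ are integers. Jumps and averages: for a function $\mathbf U$ smooth up to the boundary on each spatial element, $\mathbf U_m^+=\lim_{x\searrow x_m}\mathbf U(x)$, $\mathbf U_m^-=\lim_{x\nearrow x_m}\mathbf U(x)$ (with periodic identification, so $\mathbf U_0^-=\mathbf U_M^-$ and $\mathbf U_M^+=\mathbf U_0^+$), $[\![\mathbf U_m]\!]=\mathbf U_m^--\mathbf U_m^+$, and $\{\!\{\mathbf U_m\}\!\}=\tfrac12(\mathbf U_m^-+\mathbf U_m^+)$. Discrete spatial derivative: $\mathcal G(\mathbf U)\in D_p(S^1)$ is defined by $$\int_{S^1}\mathcal G(\mathbf U)\cdot\phi\,dx=\sum_{m=0}^{M-1}\int_{J_m}\mathbf U_x\cdot\phi\,dx-\sum_{m=0}^{M-1}[\![\mathbf U_m]\!]\cdot\{\!\{\phi_m\}\!\}\qquad\forall\phi\in D_p(S^1).$$ The same formula, with the scalar version of $D_p(S^1)$ as test and target space, defines $\mathcal G(w)$ for a scalar piecewise polynomial function $w$ (of any degree). For functions of $(t,x)$, $\mathcal G$ acts in $x$ at each fixed $t$. Flux contributions: for a scalar function $w$ and vector functions $\mathbf U,\mathbf V$, each piecewise polynomial in $x$, $$a_m(w):=\{\!\{w_{m+1}\}\!\}-\{\!\{w_m\}\!\},$$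 $$b_m(\mathbf U,\mathbf V):=\tfrac12\big(\mathbf U_{m+1}^-\cdot\mathbf V_{m+1}^++\mathbf U_{m+1}^+\cdot\mathbf V_{m+1}^-\big)-\tfrac12\big(\mathbf U_m^-\cdot\mathbf V_m^++\mathbf U_m^+\cdot\mathbf V_m^-\big).$$ *)

(* Defs.v *)
From HB Require Import structures.
From mathcomp Require Import all_boot all_order all_algebra.
From mathcomp Require Import all_classical all_reals all_analysis.
Set Implicit Arguments.
Unset Strict Implicit.
Unset Printing Implicit Defensive.
Import Order.TTheory GRing.Theory Num.Theory.
Import numFieldNormedType.Exports.
Local Open Scope classical_set_scope.
Local Open Scope ring_scope.

Notation leb := lebesgue_measure.

Definition dot (R : realType) (k : nat) (u v : 'cV[R]_k) : R :=
  \sum_(d < k) u d 0 * v d 0.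

Definition skew_symmetric (R : realType) (k : nat) (A : 'M[R]_k) : Prop :=
  A^T = - A.

Definition grad (R : realType) (k : nat) (S : 'cV[R]_k -> R)
    (z : 'cV[R]_k) : 'cV[R]_k :=
  \col_(d < k) 'D_(delta_mx d 0) S z.

Definition C1 (R : realType) (k : nat) (S : 'cV[R]_k -> R) : Prop :=
  (forall z, differentiable S z) /\ continuous (grad S).

(* A function on a domain is represented by a total function on R, of which
   only the values on the domain matter. *)

(* Only [node 0, ..., node nelem] are meaningful. *)
Record mesh (R : realType) (a b : R) := Mesh {
  nelem : nat;
  node : nat -> R;
  node_first : node 0%N = a;
  node_last : node nelem = b;
  node_lt : forall i, (i < nelem)%N -> node i < node i.+1 }.

Definition poly_on (R : realType) (A : set R) (r : nat) (f : R -> R) : Prop :=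
  exists P : {poly R}, (size P <= r.+1)%N /\ forall s, A s -> f s = P.[s].

Section FiniteElementSpaces.
Context {R : realType}.

Definition telem (T : R) (tm : mesh 0 T) (n : nat) : set R :=
  `[node tm n, node tm n.+1[.

Definition xelem (xm : mesh (0 : R) 1) (m : nat) : set R :=
  `]node xm m, node xm m.+1[.

Definition Dt (T : R) (tm : mesh 0 T) (q : nat) : set (R -> R) :=
  [set f | forall n, (n < nelem tm)%N -> poly_on (telem tm n) q f].

Definition Ct (T : R) (tm : mesh 0 T) (r : nat) : set (R -> R) :=
  Dt tm r `&` [set f | {within `[0, T], continuous f}].

(* The values at the nodes are unconstrained. *)
Definition Dx (xm : mesh (0 : R) 1) (p : nat) : set (R -> R) :=
  [set f | forall m, (m < nelem xm)%N -> poly_on (xelem xm m) p f].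

Definition Dxv (xm : mesh (0 : R) 1) (p k : nat) : set (R -> 'cV[R]_k) :=
  [set U | forall d, Dx xm p (fun x => U x d 0)].

(* [tensor A X Y]: functions on A x S^1, each component of which lies in the
   (algebraic) tensor product of X and Y. *)
Definition tensor (k : nat) (A : set R) (X Y : set (R -> R)) :
    set (R -> R -> 'cV[R]_k) :=
  [set U | forall d, exists (j : nat) (u v : 'I_j -> R -> R),
    [/\ forall i, X (u i), forall i, Y (v i) &
        forall t x, A t -> `[0, 1[%classic x ->
          U t x d 0 = \sum_(i < j) u i t * v i x]].

End FiniteElementSpaces.

Definition square_integrable (R : realType) (k : nat) (f : R -> 'cV[R]_k) :
    Prop :=
  let S1 : set (measurableTypeR R) := `[0, 1[%classic in
  forall d, measurable_fun S1 (fun x => f x d 0) /\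
    leb.-integrable S1 (fun x => ((f x d 0) ^+ 2)%:E).

Section SpatialOperators.
Context {R : realType} (xm : mesh (0 : R) 1).

(* One-sided limits at x_m, 0 <= m <= M, where x_0 and x_M are identified. *)
Definition trace_minus (V : normedModType R) (U : R -> V) (m : nat) : V :=
  lim (U x @[x --> (node xm (if m == 0%N then nelem xm else m))^'-]).

Definition trace_plus (V : normedModType R) (U : R -> V) (m : nat) : V :=
  lim (U x @[x --> (node xm (if m == nelem xm then 0%N else m))^'+]).

Definition jump (V : normedModType R) (U : R -> V) (m : nat) : V :=
  trace_minus U m - trace_plus U m.

Definition avg (V : normedModType R) (U : R -> V) (m : nat) : V :=
  2^-1 *: (trace_minus U m + trace_plus U m).

Definition is_disc_deriv (p k : nat) (U g : R -> 'cV[R]_k) : Prop :=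
  Dxv xm p g /\
  forall phi, Dxv xm p phi ->
    \int[leb]_(x in `[0, 1[) dot (g x) (phi x) =
    \sum_(m < nelem xm) \int[leb]_(x in xelem xm m) dot (derive1 U x) (phi x)
    - \sum_(m < nelem xm) dot (jump U m) (avg phi m).

(* On each element, the function satisfying [is_disc_deriv] is unique; its
   values at the nodes are arbitrary. *)
Definition disc_deriv (p k : nat) (U : R -> 'cV[R]_k) : R -> 'cV[R]_k :=
  xget (fun=> 0) [set g | is_disc_deriv p U g].

(* Scalar functions are identified with functions with values in R^1. *)
Definition disc_deriv1 (p : nat) (w : R -> R) (x : R) : R :=
  disc_deriv p (fun y => (w y)%:M : 'cV[R]_1) x 0 0.

Definition is_proj0 (p k : nat) (f g : R -> 'cV[R]_k) : Prop :=
  Dxv xm p g /\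
  forall phi, Dxv xm p phi ->
    \int[leb]_(x in `[0, 1[) dot (f x - g x) (phi x) = 0.

Definition proj0 (p k : nat) (f : R -> 'cV[R]_k) : R -> 'cV[R]_k :=
  xget (fun=> 0) [set g | is_proj0 p f g].

Definition flux_a (w : R -> R) (m : nat) : R :=
  avg (w : R -> R^o) m.+1 - avg (w : R -> R^o) m.

Definition flux_b (k : nat) (U V : R -> 'cV[R]_k) (m : nat) : R :=
  2^-1 * (dot (trace_minus U m.+1) (trace_plus V m.+1)
          + dot (trace_plus U m.+1) (trace_minus V m.+1))
  - 2^-1 * (dot (trace_minus U m) (trace_plus V m)
            + dot (trace_plus U m) (trace_minus V m)).

End SpatialOperators.

Section SpaceTime.
Context {R : realType} (T : R) (tm : mesh 0 T) (xm : mesh (0 : R) 1).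

Definition dt (V : normedModType R) (f : R -> R -> V) (t x : R) : V :=
  derive1 (f^~ x) t.

(* D_q(I_n) x D_p(S^1) *)
Definition local_space (q p k n : nat) : set (R -> R -> 'cV[R]_k) :=
  tensor (telem tm n) (poly_on (telem tm n) q) (Dx xm p).

Definition is_st_proj (q p k n : nat) (V P : R -> R -> 'cV[R]_k) : Prop :=
  local_space q p n P /\
  forall phi, local_space q p n phi ->
    \int[leb]_(t in telem tm n) \int[leb]_(x in `[0, 1[)
      dot (V t x - P t x) (phi t x) = 0.

Definition st_proj (q p k n : nat) (V : R -> R -> 'cV[R]_k) :
    R -> R -> 'cV[R]_k :=
  xget (fun _ _ => 0) [set P | is_st_proj q p n V P].

End SpaceTime.

(* Main.v *)
Require Import Defs.
From HB Require Import structures.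
From mathcomp Require Import all_boot all_order all_algebra.
From mathcomp Require Import all_classical all_reals all_analysis
  measurable_realfun.
From mathcomp Require Import ring lra.
Import Order.TTheory GRing.Theory Num.Theory.
Import numFieldNormedType.Exports.
Local Open Scope classical_set_scope.
Local Open Scope ring_scope.
Set Implicit Arguments.
Unset Strict Implicit.
Unset Printing Implicit Defensive.

(** The two laws hold because of one algebraic identity in space and three
    admissible test functions.

    On a time element [I_n], a discrete solution is on each space element
    [J_m] a polynomial in [t] and [x].  Since no continuity is imposed between
    space elements, the discrete derivative splits into one problem on each
    element: its right-hand side is the linear form [elem_form], which keeps at
    either end point half of the jump found there.  Hence the discrete
    derivative acts on the coefficients of the powers of [t], and commutes with
    the time derivative.

    Fix [t] and write [u = Z_t], [v = Z], with discrete derivatives [Gu] and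
    [Gv].  For a skew matrix [A],
    [1/2 (Gu . A v - Gv . A u + G(u . A v))] has an integral over [J_m] which
    is exactly the flux of the statement ([elem_flux]).  Pair by pair of
    components this is [elem_form_flux]: the volume terms of the three forms
    add up to twice the integral of [(u v)_x], and the boundary values
    rearrange into averages and mixed products.

    The densities of the two laws differ from this expression by terms whose
    space-time integral over [I_n x J_m] vanishes.  For the energy, the
    difference is minus the residual of the method tested with [Z_t], because
    [Z_t . K Z_t = 0].  For the momentum, it is the residual of the method
    tested with [P(G(Z))], plus the defect [G(Z) - P(G(Z))] tested with
    [K Z_t] and with [L P(G(Z))], which the projection annihilates.  All these
    test functions may be cut off outside [I_n x J_m] ([method_residual],
    [st_proj_bipoly]).  Finally the fluxes telescope around the periodic mesh,
    so that the sum of the local laws is the global one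
    ([laws_of_elem_identity]).

    Values at the nodes are unspecified for the spatial derivative and for the
    time derivative; every integral is therefore first reduced to open
    elements, where the integrand agrees with a continuous function. *)

(** * Integrals over open intervals *)

Section Integrals.
Context {R : realType}.
Implicit Types (a b : R) (f g : R -> R) (P : {poly R}).

Lemma integrable_oo a b f : continuous f ->
  leb.-integrable (`]a, b[%classic : set R) (EFin \o f).
Proof.
move=> cf; apply: (@integrableS _ _ _ leb (`[a, b]%classic : set R)) => //.
  exact: subset_itv_oo_cc.
apply: continuous_compact_integrable; first exact: segment_compact.
exact: continuous_subspaceT.
Qed.

Lemma integral_ooD a b f g : continuous f -> continuous g ->
  \int[leb]_(x in `]a, b[) (f x + g x) =
  \int[leb]_(x in `]a, b[) f x + \int[leb]_(x in `]a, b[) g x.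
Proof. by move=> cf cg; apply: RintegralD => //; exact: integrable_oo. Qed.

Lemma integral_ooB a b f g : continuous f -> continuous g ->
  \int[leb]_(x in `]a, b[) (f x - g x) =
  \int[leb]_(x in `]a, b[) f x - \int[leb]_(x in `]a, b[) g x.
Proof. by move=> cf cg; apply: RintegralB => //; exact: integrable_oo. Qed.

Lemma integral_ooZ a b c f : continuous f ->
  \int[leb]_(x in `]a, b[) (c * f x) = c * \int[leb]_(x in `]a, b[) f x.
Proof. by move=> cf; apply: RintegralZl => //; exact: integrable_oo. Qed.

Lemma integrable_co a b f g : continuous g -> {in `]a, b[, f =1 g} ->
  leb.-integrable (`[a, b[%classic : set R) (EFin \o f).
Proof.
move=> cg fg; have [ab|ba] := ltP a b; last first.
  by rewrite set_itv_ge ?bnd_simp -?leNgt//; exact: integrable_set0.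
have := integrable_oo a b cg => ig.
have {ig} : leb.-integrable (`]a, b[%classic : set R) (EFin \o f).
  apply: eq_integrable ig => // x; rewrite inE/= => xab.
  by rewrite fg.
move=> /integrableP[mf fin]; apply/integrableP; split.
  by apply/(emeasurable_fun_itv_obnd_cbndP a (BLeft b) (EFin \o f)).
rewrite (@integral_itv_bndoo R a b _ true true) //.
exact: measurableT_comp.
Qed.

(** Only the open interval matters: this discards the values at the nodes of
    the time mesh, where a time derivative need not exist. *)
Lemma co_integral a b f g : continuous g -> {in `]a, b[, f =1 g} ->
  \int[leb]_(x in `[a, b[) f x = \int[leb]_(x in `]a, b[) g x.
Proof.
move=> cg fg; rewrite -Rintegral_itv_obnd_cbnd.
  by apply: eq_Rintegral => x; rewrite inE => /fg.
by apply: integrableS (integrable_co cg fg) => //; exact: subset_itv_oo_co.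
Qed.

Lemma split_integral (s : nat -> R) (N : nat) f :
  (forall m, (m < N)%N -> s m < s m.+1) ->
  (forall m, (m < N)%N -> exists2 g, continuous g & {in `]s m, s m.+1[, f =1 g}) ->
  \int[leb]_(x in `[s 0%N, s N[) f x =
  \sum_(m < N) \int[leb]_(x in `]s m, s m.+1[) f x.
Proof.
move=> sN fN.
suff: forall n, (n <= N)%N -> [/\ s 0%N <= s n,
   leb.-integrable (`[s 0%N, s n[%classic : set R) (EFin \o f) &
   \int[leb]_(x in `[s 0%N, s n[) f x =
   \sum_(m < n) \int[leb]_(x in `]s m, s m.+1[) f x].
  by move=> /(_ N (leqnn _))[].
elim=> [_|n IH nN].
  rewrite set_itv_ge ?bnd_simp ?ltxx//; split => //.
    exact: integrable_set0.
  by rewrite big_ord0 Rintegral_set0.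
have [s0n ifn E] := IH (ltnW nN).
have snn := sN _ nN.
have [g cg fg] := fN _ nN.
have U : `[s 0%N, s n.+1[%classic =
  `[s 0%N, s n[%classic `|` `[s n, s n.+1[%classic.
  apply/itv_bndbnd_setU; rewrite bnd_simp //; exact: ltW.
have D : [disjoint `[s 0%N, s n[%classic & `[s n, s n.+1[%classic].
  apply/disj_setPS => x [] /=; rewrite !in_itv/= => /andP[_ +] /andP[+ _].
  by move=> /lt_le_trans/[apply]; rewrite ltxx.
have iU : leb.-integrable (`[s 0%N, s n.+1[%classic : set R) (EFin \o f).
  have [mA IA] := integrableP _ _ _ ifn.
  have [mB IB] := integrableP _ _ _ (integrable_co cg fg).
  rewrite U; apply/integrableP; split; first exact/measurable_funU.
  rewrite ge0_integral_setU//; first exact: lte_add_pinfty.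
  by apply: measurableT_comp => //; exact/measurable_funU.
split; [exact: le_trans (ltW snn)|exact: iU|].
rewrite U Rintegral_setU//; last by rewrite -U.
rewrite big_ord_recr/= E (co_integral cg fg); congr (_ + _).
by apply: eq_Rintegral => x; rewrite inE => /fg.
Qed.

Lemma continuous_slicel (h : R -> R -> R) t :
  continuous (fun z : R * R => h z.1 z.2) -> continuous (h t).
Proof.
move=> ch x; apply: (@continuous_comp _ _ _ (fun x => (t, x)) (fun z => h z.1 z.2)).
  exact: (cvg_pair (cvg_cst t) (@cvg_id _ (nbhs x))).
exact: ch.
Qed.

Lemma continuous_slicer (h : R -> R -> R) x :
  continuous (fun z : R * R => h z.1 z.2) -> continuous (h ^~ x).
Proof.
move=> ch t; apply: (@continuous_comp _ _ _ (fun t => (t, x)) (fun z => h z.1 z.2)).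
  exact: (cvg_pair (@cvg_id _ (nbhs t)) (cvg_cst x)).
exact: ch.
Qed.

(** Dominated convergence, with the maximum of the integrand on a compact
    rectangle around [t0] as the bound. *)
Lemma continuous_param (h : R -> R -> R) a b :
  continuous (fun z : R * R => h z.1 z.2) ->
  continuous (fun t => \int[leb]_(x in `]a, b[) h t x).
Proof.
move=> ch t0.
have cx := continuous_slicel ch; have ct := continuous_slicer ch.
have [M HM] : exists M, forall t x, `[t0 - 1, t0 + 1]%classic t ->
  `[a, b]%classic x -> `|h t x| <= M.
  have := compact_setX (@segment_compact R (t0 - 1) (t0 + 1))
    (@segment_compact R a b).
  move=> /(continuous_compact (continuous_subspaceT ch))/compact_bounded[M [_ HM]].
  exists (M + 1) => t x tI xI; apply: (HM (M + 1)); first by rewrite ltrDl.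
  by exists (t, x).
apply: (@continuity_under_integral R _ _ leb h `]a, b[%classic _ (t0 - 1)
  (t0 + 1) _ _ (cst M)) => //.
- by move=> t _; exact/integrable_oo/cx.
- by apply: aeW => x _ t _; exact: ct.
- by apply: integrable_oo => x; exact: cvg_cst.
- move=> t tI; apply: aeW => x xI; apply: HM; exact: subset_itv_oo_cc.
- by rewrite inE/= in_itv/= ltrDl ltrBlDr ltrDl ltr01.
Qed.

Lemma Rintegral_sub (A B : set R) f : A `<=` B ->
  (forall x, B x -> ~ A x -> f x = 0) ->
  \int[leb]_(x in B) f x = \int[leb]_(x in A) f x.
Proof.
move=> AB f0; rewrite -(setIidr AB) Rintegral_mkcondr.
apply: eq_Rintegral => x; rewrite inE => Bx; rewrite patchE.
by case: ifPn => //; rewrite notin_setE; exact: f0.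
Qed.

Definition pint a b P : R := \int[leb]_(x in `]a, b[) P.[x].

Lemma pintD a b P Q : pint a b (P + Q) = pint a b P + pint a b Q.
Proof.
rewrite /pint -integral_ooD; [|exact: continuous_horner..].
by apply: eq_Rintegral => x _; rewrite hornerD.
Qed.

Lemma pintZ a b c P : pint a b (c *: P) = c * pint a b P.
Proof.
rewrite /pint -integral_ooZ; last exact: continuous_horner.
by apply: eq_Rintegral => x _; rewrite hornerZ.
Qed.

Lemma pint_is_linear a b : scalar (pint a b).
Proof. by move=> c P Q; rewrite pintD pintZ. Qed.
HB.instance Definition _ a b :=
  GRing.isLinear.Build R {poly R} R _ (pint a b) (pint_is_linear a b).

Lemma pint_deriv a b P : a < b -> pint a b P^`() = P.[b] - P.[a].
Proof.
move=> ab; have cP := @continuous_horner R.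
rewrite /pint Rintegral_itv_obnd_cbnd; last exact/integrable_oo/cP.
rewrite Rintegral_itv_bndo_bndc; last first.
  by apply: (@integrable_co _ _ _ _ (cP _)) => x _.
rewrite /Rintegral (@continuous_FTC2 R _ (horner P))//.
- exact/continuous_subspaceT/cP.
- split => [x _||]; first exact: derivable_horner.
  + exact/cvg_at_right_filter/cP.
  + exact/cvg_at_left_filter/cP.
- by move=> x _; rewrite -derivE.
Qed.

Definition primitive P : {poly R} :=
  \poly_(i < (size P).+1) (P`_i.-1 / i%:R).

Lemma deriv_primitive P : (primitive P)^`() = P.
Proof.
apply/polyP => i; rewrite coef_deriv coef_poly ltnS/=.
case: ltnP => iP; last by rewrite mul0rn nth_default.
by rewrite -[LHS]mulr_natr divfK// pnatr_eq0.
Qed.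

(** A nonzero polynomial has fewer roots than its size. *)
Lemma poly0_oo a b P : a < b -> (forall x, a < x < b -> P.[x] = 0) -> P = 0.
Proof.
move=> ab P0; apply/eqP/negPn/negP => nP.
(* as many distinct points of the interval as the size of P *)
pose s := [seq a + (b - a) / k.+2%:R | k <- iota 0 (size P)].
have: (size s < size P)%N.
  apply: max_poly_roots => //.
    apply/allP => _ /mapP[k _ ->]; apply/rootP/P0.
    rewrite ltrDl divr_gt0 ?subr_gt0 ?ltr0n//=.
    by rewrite -ltrBrDl ltr_pdivrMr ?ltr0n// ltr_pMr ?subr_gt0// ltr1n.
  rewrite map_inj_in_uniq ?iota_uniq// => i j _ _ /addrI.
  move/(mulfI _); rewrite subr_eq0 gt_eqF// => /(_ isT)/invr_inj/eqP.
  by rewrite eqr_nat => /eqP[].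
by rewrite size_map size_iota ltnn.
Qed.

Lemma pint_ge0 a b P : (forall x, 0 <= P.[x]) -> 0 <= pint a b P.
Proof. by move=> P0; apply: Rintegral_ge0. Qed.

(** A primitive [F] of [P ^+ 2] is nondecreasing and takes equal values at [a]
    and [b], so it is constant on the interval, hence constant. *)
Lemma pint_sqr0 a b P : a < b -> pint a b (P ^+ 2) = 0 -> P = 0.
Proof.
move=> ab I0.
suff: P ^+ 2 = 0 by move/eqP; rewrite expf_eq0 => /eqP.
pose F := primitive (P ^+ 2).
have F0 : F.[b] - F.[a] = 0 by rewrite -pint_deriv// deriv_primitive.
have Q0 x : 0 <= (P ^+ 2).[x] by rewrite horner_exp sqr_ge0.
have FC : F - F.[a]%:P = 0.
  apply: (@poly0_oo a b) => // x /andP[ax xb].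
  have := pint_ge0 a x Q0; have := pint_ge0 x b Q0.
  rewrite -[P ^+ 2]deriv_primitive !pint_deriv// -/F.
  rewrite (subr0_eq F0) !hornerE !subr_ge0 => h1 h2.
  by apply/eqP; rewrite subr_eq0 eq_le h1 h2.
by rewrite -[P ^+ 2]deriv_primitive -/F (subr0_eq FC) derivC.
Qed.

(** The Gram matrix [M] of the monomials is invertible, because a vector of
    its kernel gives a polynomial whose square has integral zero.  Both the
    discrete derivative and the projection in time are obtained from this. *)
Lemma poly_riesz a b (p : nat) (l : {poly R} -> R) : a < b -> scalar l ->
  exists2 G : {poly R}, (size G <= p.+1)%N &
    forall phi : {poly R}, (size phi <= p.+1)%N -> pint a b (G * phi) = l phi.
Proof.
move=> ab lin.
pose lL := GRing.isLinear.Build R {poly R} R _ l lin.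
pose L : {linear {poly R} -> R | *%R} := HB.pack l lL.
pose M : 'M[R]_p.+1 := \matrix_(i, j) pint a b ('X^i * 'X^j).
have rE (v : 'rV[R]_p.+1) : rVpoly v = \sum_i v 0 i *: 'X^i.
  rewrite -[rVpoly v]/(\poly_(k < p.+1) _) poly_def; apply: eq_bigr => i _.
  by rewrite valK.
have ME (v : 'rV[R]_p.+1) j : (v *m M) 0 j = pint a b (rVpoly v * 'X^j).
  rewrite mxE rE mulr_suml linear_sum; apply: eq_bigr => i _.
  by rewrite mxE -scalerAl linearZ.
have IE (u v : 'rV[R]_p.+1) :
    pint a b (rVpoly u * rVpoly v) = \sum_j v 0 j * (u *m M) 0 j.
  rewrite [in LHS](rE v) mulr_sumr linear_sum; apply: eq_bigr => i _.
  by rewrite -scalerAr linearZ ME.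
have Mu : M \in unitmx.
  rewrite -row_free_unit -kermx_eq0; apply/eqP/row_matrixP => i.
  set v := row i _.
  have vM : v *m M = 0 by rewrite -row_mul mulmx_ker row0.
  have : pint a b (rVpoly v ^+ 2) = 0.
    by rewrite expr2 IE vM big1// => j _; rewrite [X in _ * X]mxE mulr0.
  move=> /(pint_sqr0 ab) v0; rewrite row0 -[v]rVpolyK v0.
  by rewrite linear0.
pose u := (\row_j l 'X^j) *m invmx M.
exists (rVpoly u); first by rewrite size_poly.
move=> phi sphi; rewrite -(poly_rV_K sphi) IE mulmxKV//.
rewrite [in RHS]rE -[l _]/(L _) linear_sum; apply: eq_bigr => j _.
by rewrite linearZ [X in _ * X]mxE.
Qed.

End Integrals.

(** * Traces of functions that are polynomial on each space element *)

Section Piecewise.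
Context {R : realType} (xm : mesh (0 : R) 1).
Local Notation M := (nelem xm).
Local Notation nd := (node xm).
Local Notation J := (xelem xm).

Lemma mesh_mono (a b : R) (s : mesh a b) i j :
  (i <= j <= nelem s)%N -> node s i <= node s j.
Proof.
move=> /andP[]; elim: j => [|j IH]; first by rewrite leqn0 => /eqP->.
rewrite leq_eqVlt => /predU1P[->//|]; rewrite ltnS => ij jM.
by rewrite (le_trans (IH ij (ltnW jM)))// ltW// node_lt.
Qed.

Lemma mesh_sub (a b : R) (s : mesh a b) m : (m < nelem s)%N ->
  `[node s m, node s m.+1[%classic `<=` `[a, b[%classic.
Proof.
move=> mM x; rewrite /= !in_itv/= => /andP[mx xm1].
have am : a <= node s m by rewrite -[leLHS](node_first s) mesh_mono ?(ltnW mM).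
have mb : node s m.+1 <= b by rewrite -[leRHS](node_last s) mesh_mono ?mM/=.
by rewrite (le_trans am mx) (lt_le_trans xm1 mb).
Qed.

Lemma mesh_inj (a b : R) (s : mesh a b) m m' x : (m < nelem s)%N ->
  (m' < nelem s)%N ->
  x \in `[node s m, node s m.+1[ -> x \in `[node s m', node s m'.+1[ -> m = m'.
Proof.
wlog mm' : m m' / (m <= m')%N.
  by move=> H; case/orP: (leq_total m m') => h *; [exact: H|apply/esym/H].
move=> mM mM'; rewrite !in_itv/= => /andP[_ xm1] /andP[xm' _].
apply/eqP; rewrite eqn_leq mm' leqNgt; apply/negP => ltmm.
have := lt_le_trans xm1 (le_trans (mesh_mono (s := s) (i := m.+1) (j := m') _) xm').
by rewrite ltmm (ltnW mM') ltxx => /(_ isT).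
Qed.

Lemma xelem_sub m : (m < M)%N -> J m `<=` `[0, 1[%classic.
Proof. by move=> mM x Jx; apply: (mesh_sub mM); exact: subset_itv_oo_co. Qed.

Lemma xelem_inj m m' x : (m < M)%N -> (m' < M)%N -> J m x -> J m' x -> m = m'.
Proof.
move=> mM mM' Jx Jx'; apply: (@mesh_inj _ _ xm _ _ x mM mM').
  by move: Jx; exact: subset_itv_oo_co.
by move: Jx'; exact: subset_itv_oo_co.
Qed.

Lemma nelem_gt0 : (0 < M)%N.
Proof.
rewrite lt0n; apply/negP => /eqP M0.
have := node_last xm; rewrite M0 node_first => /esym/eqP.
by rewrite oner_eq0.
Qed.

Section Traces.
Context {V : normedModType R}.
Implicit Types U F : R -> V.

Lemma trace_plus_eq U F m : (m < M)%N -> continuous F ->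
  (forall x, J m x -> U x = F x) -> trace_plus xm U m = F (nd m).
Proof.
move=> mM cF UF; rewrite /trace_plus ltn_eqF//; apply/cvg_lim => //.
apply: (@cvg_trans _ (F x @[x --> (nd m)^'+])); last exact/cvg_at_right_filter/cF.
apply: near_eq_cvg; near=> x; apply/esym/UF; rewrite /xelem/= in_itv/=.
apply/andP; split; first by near: x; exact: nbhs_right_gt.
by near: x; apply: nbhs_right_lt; exact: node_lt.
Unshelve. all: by end_near. Qed.

Lemma trace_minus_eq U F m : (m < M)%N -> continuous F ->
  (forall x, J m x -> U x = F x) -> trace_minus xm U m.+1 = F (nd m.+1).
Proof.
move=> mM cF UF; rewrite /trace_minus/=; apply/cvg_lim => //.
apply: (@cvg_trans _ (F x @[x --> (nd m.+1)^'-])); last exact/cvg_at_left_filter/cF.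
apply: near_eq_cvg; near=> x; apply/esym/UF; rewrite /xelem/= in_itv/=.
apply/andP; split; last by near: x; exact: nbhs_left_lt.
by near: x; apply: nbhs_left_gt; exact: node_lt.
Unshelve. all: by end_near. Qed.

Lemma trace_plus_per U : trace_plus xm U M = trace_plus xm U 0.
Proof. by rewrite /trace_plus eqxx; case: eqP. Qed.

Lemma trace_minus_per U : trace_minus xm U M = trace_minus xm U 0.
Proof. by rewrite /trace_minus eqxx; case: eqP. Qed.

(** The conditionals select the element to the left of node [m], and its end
    point there: the last element when [m] is 0. *)
Lemma trace_minus_rep U (F : nat -> R -> V) m : (m <= M)%N ->
  (forall i, (i < M)%N -> continuous (F i)) ->
  (forall i, (i < M)%N -> forall x, J i x -> U x = F i x) ->
  trace_minus xm U m =
  F (if m == 0%N then M else m).-1 (nd (if m == 0%N then M else m)).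
Proof.
move=> mM cF UF.
have H i : (i < M)%N -> trace_minus xm U i.+1 = F i (nd i.+1).
  by move=> iM; exact: (trace_minus_eq iM (cF _ iM) (UF _ iM)).
case: m mM => [_|m mM]; last exact: H.
rewrite -trace_minus_per eqxx.
have := nelem_gt0; move: H; move E: M => N; case: N E => // N E H _.
exact: H.
Qed.

Lemma trace_plus_rep U (F : nat -> R -> V) m : (m <= M)%N ->
  (forall i, (i < M)%N -> continuous (F i)) ->
  (forall i, (i < M)%N -> forall x, J i x -> U x = F i x) ->
  trace_plus xm U m =
  F (if m == M then 0%N else m) (nd (if m == M then 0%N else m)).
Proof.
move=> mM cF UF.
have H i : (i < M)%N -> trace_plus xm U i = F i (nd i).
  by move=> iM; exact: (trace_plus_eq iM (cF _ iM) (UF _ iM)).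
case: eqVneq => [->|]; first by rewrite trace_plus_per; exact/H/nelem_gt0.
by move=> mnM; apply: H; rewrite ltn_neqAle mnM.
Qed.

End Traces.

(** Summation over nodes and summation over elements by their right end
    points agree on a periodic mesh. *)
Lemma sum_periodic (V : zmodType) N (f : nat -> V) : f 0%N = f N ->
  \sum_(m < N) f m = \sum_(m < N) f m.+1.
Proof.
case: N => [|N] f0; first by rewrite !big_ord0.
by rewrite big_ord_recl big_ord_recr/= f0 addrC.
Qed.

Implicit Types (u v w : nat -> {poly R}).
(** Traces of a piecewise polynomial function given by its polynomials [w];
    they coincide with [trace_minus] and [trace_plus], without any limit. *)
Definition trm w m : R :=
  (w (if m == 0%N then M else m).-1).[nd (if m == 0%N then M else m)].
Definition trp w m : R :=
  (w (if m == M then 0%N else m)).[nd (if m == M then 0%N else m)].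

Lemma trmS w m : trm w m.+1 = (w m).[nd m.+1]. Proof. by []. Qed.
Lemma trp_lt w m : (m < M)%N -> trp w m = (w m).[nd m].
Proof. by move=> mM; rewrite /trp ltn_eqF. Qed.
Lemma trm_per w : trm w M = trm w 0.
Proof. by rewrite /trm eqxx; case: eqP. Qed.
Lemma trp_per w : trp w M = trp w 0.
Proof. by rewrite /trp eqxx; case: eqP. Qed.

Lemma trm_lin c u v m : trm (fun i => c *: u i + v i) m = c * trm u m + trm v m.
Proof. by rewrite /trm hornerD hornerZ. Qed.
Lemma trp_lin c u v m : trp (fun i => c *: u i + v i) m = c * trp u m + trp v m.
Proof. by rewrite /trp hornerD hornerZ. Qed.

(** * The discrete derivative, element by element *)

(** The share of element [m] in the right-hand side that defines the discrete
    derivative of [w], for a test function equal to [phi] on that element: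
    each average contains one trace from this element, with weight 1/2. *)
Definition elem_form w m (phi : {poly R}) : R :=
  pint (nd m) (nd m.+1) ((w m)^`() * phi)
  - 2^-1 * (trm w m - trp w m) * phi.[nd m]
  - 2^-1 * (trm w m.+1 - trp w m.+1) * phi.[nd m.+1].

Lemma elem_form_linr w m : scalar (elem_form w m).
Proof.
move=> c u v; rewrite /elem_form mulrDr -scalerAr pintD pintZ !hornerD !hornerZ;
  ring.
Qed.
HB.instance Definition _ w m :=
  GRing.isLinear.Build R {poly R} R _ (elem_form w m) (@elem_form_linr w m).

Lemma elem_form_linl c u v m phi :
  elem_form (fun i => c *: u i + v i) m phi = c * elem_form u m phi +
    elem_form v m phi.
Proof.
rewrite /elem_form derivD derivZ mulrDl -scalerAl pintD pintZ !trm_lin !trp_lin;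
  ring.
Qed.

Lemma elem_form0l m phi : elem_form (fun=> 0) m phi = 0.
Proof. by rewrite /elem_form deriv0 mul0r linear0 /trm /trp !horner0; ring. Qed.

Lemma elem_formZl c u m phi : elem_form (fun i => c *: u i) m phi =
  c * elem_form u m phi.
Proof.
rewrite -[RHS]addr0 -(elem_form0l m phi) -elem_form_linl.
by congr (elem_form _ m phi); apply/funext => i; rewrite addr0.
Qed.

Lemma elem_form_suml N (u : 'I_N -> nat -> {poly R}) m phi :
  elem_form (fun i => \sum_j u j i) m phi = \sum_j elem_form (u j) m phi.
Proof.
elim: N u => [|N IH] u.
  rewrite big_ord0 -[RHS](elem_form0l m phi); congr (elem_form _ m phi).
  by apply/funext => i; rewrite big_ord0.
rewrite big_ord_recl -IH -[X in X + _]mul1r -elem_form_linl;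
  congr (elem_form _ m phi).
by apply/funext => i; rewrite big_ord_recl scale1r.
Qed.

Definition pflux_a w m : R :=
  2^-1 * (trm w m.+1 + trp w m.+1) - 2^-1 * (trm w m + trp w m).
Definition pflux_b u v m : R :=
  2^-1 * (trm u m.+1 * trp v m.+1 + trp u m.+1 * trm v m.+1)
  - 2^-1 * (trm u m * trp v m + trp u m * trm v m).

(** The three volume terms add up to twice the integral of [(u v)'], that is,
    to twice the difference of the inner traces of [u v] at the end points;
    half of the jumps is then exactly what turns these into averages of [u v]
    and mixed products. *)
Lemma elem_form_flux u v m : (m < M)%N ->
  elem_form u m (v m) + elem_form v m (u m) + elem_form (fun i => u i * v i) m 1 =
  pflux_a (fun i => u i * v i) m + pflux_b u v m.
Proof.
move=> mM; have lt := node_lt mM.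
rewrite /elem_form mulr1.
have E : pint (nd m) (nd m.+1) ((u m)^`() * v m) +
  pint (nd m) (nd m.+1) ((v m)^`() * u m)
   = pint (nd m) (nd m.+1) (u m * v m)^`().
  by rewrite derivM linearD/= [_ * (v m)^`()]mulrC.
have E2 := pint_deriv (u m * v m) lt; rewrite -E in E2 *.
rewrite /pflux_a /pflux_b.
have -> : trm (fun i => u i * v i) m = trm u m * trm v m by rewrite /trm hornerM.
have -> : trp (fun i => u i * v i) m = trp u m * trp v m by rewrite /trp hornerM.
have -> : trm (fun i => u i * v i) m.+1 =
  trm u m.+1 * trm v m.+1 by rewrite /trm hornerM.
have -> : trp (fun i => u i * v i) m.+1 =
  trp u m.+1 * trp v m.+1 by rewrite /trp hornerM.
move: E2; rewrite !hornerM -!trmS -(trp_lt u mM) -(trp_lt v mM).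
rewrite !hornerC.
move: (pint _ _ _) (pint _ _ _) => i1 i2 E2.
have -> : i1 = trm u m.+1 * trm v m.+1 - trp u m * trp v m - i2 by rewrite -E2;
  ring.
by field.
Qed.

Definition elem_deriv p w (g : nat -> {poly R}) := forall m, (m < M)%N ->
  (size (g m) <= p.+1)%N /\
  forall phi : {poly R}, (size phi <= p.+1)%N ->
    pint (nd m) (nd m.+1) (g m * phi) = elem_form w m phi.

(** The size bound on all indices, also beyond the mesh, lets the polynomials
    serve later as coefficients without side conditions. *)
Lemma elem_deriv_exists p w : exists2 g, elem_deriv p w g & forall m,
  (size (g m) <= p.+1)%N.
Proof.
suff /choice[g gP] : forall m, exists g : {poly R}, (size g <= p.+1)%N /\
    ((m < M)%N -> forall phi : {poly R}, (size phi <= p.+1)%N ->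
      pint (nd m) (nd m.+1) (g * phi) = elem_form w m phi).
  by exists g => m; have [] := gP m => // s E mM; split => //; exact: E.
move=> m; have [mM|mM] := ltnP m M; last by exists 0; rewrite size_poly0.
by have [g sg E] := poly_riesz p (node_lt mM) (@elem_form_linr w m); exists g.
Qed.

Lemma elem_deriv_unique p w (g g' : nat -> {poly R}) : elem_deriv p w g ->
  elem_deriv p w g' ->
  forall m, (m < M)%N -> g m = g' m.
Proof.
move=> dg dg' m mM; have [s E] := dg m mM; have [s' E'] := dg' m mM.
apply/subr0_eq/(pint_sqr0 (node_lt mM)).
have sd : (size (g m - g' m)%R <= p.+1)%N.
  by rewrite (leq_trans (size_polyD _ _))// geq_max size_polyN s.
by rewrite expr2 mulrBl linearB/= E ?E' ?subrr.
Qed.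

Lemma elem_deriv_lin p c u v gu gv : elem_deriv p u gu -> elem_deriv p v gv ->
  elem_deriv p (fun i => c *: u i + v i) (fun i => c *: gu i + gv i).
Proof.
move=> du dv m mM; have [s E] := du m mM; have [s' E'] := dv m mM; split.
  rewrite (leq_trans (size_polyD _ _))// geq_max s'
    (leq_trans (size_scale_leq _ _))//.
by move=> phi sphi; rewrite elem_form_linl mulrDl -scalerAl pintD pintZ E ?E'.
Qed.

Lemma elem_deriv0 p : elem_deriv p (fun=> 0) (fun=> 0).
Proof.
move=> m mM; rewrite size_poly0; split => // phi _.
by rewrite mul0r linear0 elem_form0l.
Qed.

Lemma elem_deriv_sum p N (c : nat -> R) (u gu : nat -> nat -> {poly R}) :
  (forall k, elem_deriv p (u k) (gu k)) ->
  elem_deriv p (fun i => \sum_(k < N) c k *: u k i) (fun i =>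
    \sum_(k < N) c k *: gu k i).
Proof.
move=> du; elim: N => [|N IH].
  have E (v : nat -> nat -> {poly R}) : (fun i => \sum_(k < 0) c k *: v k i) =
    fun=> 0.
    by apply/funext => i; rewrite big_ord0.
  by rewrite !E; exact: elem_deriv0.
have E (v : nat -> nat -> {poly R}) : (fun i => \sum_(k < N.+1) c k *: v k i) =
    fun i => c N *: v N i + \sum_(k < N) c k *: v k i.
  by apply/funext => i; rewrite big_ord_recr addrC.
by rewrite !E; exact: elem_deriv_lin.
Qed.

Context {k : nat}.
Implicit Types (U g phi : R -> 'cV[R]_k) (W G Phi : nat -> 'I_k -> {poly R}).

Definition peval (F : 'I_k -> {poly R}) (x : R) : 'cV[R]_k := \col_d (F d).[x].

Lemma continuous_cV (T : topologicalType) (F : T -> 'cV[R]_k) :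
  (forall d, continuous (fun z => F z d 0)) -> continuous F.
Proof.
move=> cF.
have -> : F = (fun z => \sum_(d < k) F z d 0 *: (delta_mx d 0 : 'cV[R]_k)).
  apply/funext => z; rewrite [LHS]matrix_sum_delta; apply: eq_bigr => d _.
  by rewrite big_ord1.
apply: continuous_big => [|d _ z]; first exact: add_continuous.
by apply: cvgZr_tmp; exact: cF.
Qed.

Lemma continuous_peval F : continuous (peval F).
Proof.
apply: continuous_cV => d; rewrite (_ : (fun _ => _) = horner (F d)).
  exact: continuous_horner.
by apply/funext => x; rewrite mxE.
Qed.

Definition pw_poly W U := forall m, (m < M)%N -> forall x, J m x ->
  U x = peval (W m) x.

Lemma trace_minus_pw W U m : (m <= M)%N -> pw_poly W U ->
  trace_minus xm U m = \col_d trm (W^~ d) m.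
Proof.
move=> mM pW; rewrite (trace_minus_rep (F := fun m => peval (W m)))//.
by move=> *; exact: continuous_peval.
Qed.

Lemma trace_plus_pw W U m : (m <= M)%N -> pw_poly W U ->
  trace_plus xm U m = \col_d trp (W^~ d) m.
Proof.
move=> mM pW; rewrite (trace_plus_rep (F := fun m => peval (W m)))//.
by move=> *; exact: continuous_peval.
Qed.

Lemma dot_peval (F G : 'I_k -> {poly R}) x :
  dot (peval F x) (peval G x) = (\sum_d F d * G d).[x].
Proof.
by rewrite horner_sum; apply: eq_bigr => d _; rewrite !mxE hornerM.
Qed.

Lemma integral_dot W G U g m : (m < M)%N -> pw_poly W U -> pw_poly G g ->
  \int[leb]_(x in J m) dot (U x) (g x) =
  \sum_d pint (nd m) (nd m.+1) (W m d * G m d).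
Proof.
move=> mM pW pG; rewrite -linear_sum; apply: eq_Rintegral => x; rewrite inE => Jx.
by rewrite (pW _ mM)// (pG _ mM)// dot_peval.
Qed.

Lemma integral_S1 (f : R -> R) :
  (forall m, (m < M)%N -> exists2 g, continuous g & forall x, J m x -> f x = g x) ->
  \int[leb]_(x in `[0, 1[) f x = \sum_(m < M) \int[leb]_(x in J m) f x.
Proof.
move=> H; rewrite -[X in
  `[X, _[](node_first xm)
    -[X in `[_, X[](node_last xm) (split_integral (@node_lt _ _ _ xm))//.
Qed.

Lemma integral_dot_S1 W G U g : pw_poly W U -> pw_poly G g ->
  \int[leb]_(x in `[0, 1[) dot (U x) (g x) =
  \sum_(m < M) \sum_d pint (nd m) (nd m.+1) (W m d * G m d).
Proof.
move=> pW pG; rewrite integral_S1.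
  by apply: eq_bigr => m _; rewrite (integral_dot _ pW pG).
move=> m mM; exists (horner (\sum_d W m d * G m d)); first exact: continuous_horner.
by move=> x Jx; rewrite (pW _ mM)// (pG _ mM)// dot_peval.
Qed.

Lemma pw_poly_derive1 W U : pw_poly W U ->
  pw_poly (fun m d => (W m d)^`()) (derive1 U).
Proof.
move=> pW m mM x Jx; rewrite derive1E.
have Jn : \forall y \near x, U y = peval (W m) y.
  have : open (J m) by exact: interval_open.
  by rewrite openE => /(_ _ Jx); apply: filterS => y /(pW _ mM).
rewrite (near_eq_derive _ Jn).
have dv : derivable (peval (W m)) x 1.
  apply/derivable_mxP => d j; rewrite (_ : (fun _ => _) = horner (W m d)).
    exact: derivable_horner.
  by apply/funext => y; rewrite mxE.
rewrite derive_mx//; apply/colP => d; rewrite !mxE derivE derive1E.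
by rewrite (_ : (fun t => _) = horner (W m d))//; apply/funext => y; rewrite mxE.
Qed.

(** Every average is split into its two traces.  The terms with a left trace
    are then re-indexed, so that those attached to the same element meet. *)
Lemma disc_rhs W Phi U phi : pw_poly W U -> pw_poly Phi phi ->
  \sum_(m < M) \int[leb]_(x in J m) dot (derive1 U x) (phi x)
    - \sum_(m < M) dot (jump xm U m) (avg xm phi m) =
  \sum_(m < M) \sum_d elem_form (W^~ d) m (Phi m d).
Proof.
move=> pW pP.
under eq_bigr do rewrite (integral_dot _ (pw_poly_derive1 pW) pP)//.
have -> : \sum_(m < M) dot (jump xm U m) (avg xm phi m) =
   \sum_(m < M) \sum_d 2^-1 * (trm (W^~ d) m - trp (W^~ d) m) * (Phi m d).[nd m] +
   \sum_(m < M) \sum_d 2^-1 * (trm (W^~ d) m.+1 - trp (W^~ d) m.+1) *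
     (Phi m d).[nd m.+1].
  pose f m := \sum_d 2^-1 * (trm (W^~ d) m - trp (W^~ d) m) * trm (Phi^~ d) m.
  transitivity (\sum_(m < M) \sum_d 2^-1 * (trm (W^~ d) m - trp (W^~ d) m) * trp
    (Phi^~ d) m + \sum_(m < M) f m).
    rewrite -big_split; apply: eq_bigr => m _ /=; rewrite /f -big_split/=.
    have mM := ltnW (ltn_ord m).
    rewrite /jump /avg !(trace_minus_pw mM pW) !(trace_plus_pw mM pW)
      !(trace_minus_pw mM pP) !(trace_plus_pw mM pP).
    by apply: eq_bigr => d _; rewrite !mxE; ring.
  congr (_ + _).
    by apply: eq_bigr => m _; apply: eq_bigr => d _;
      rewrite (trp_lt (Phi^~ d) (ltn_ord m)).
  rewrite sum_periodic//; rewrite /f; apply: eq_bigr => d _.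
  by rewrite !trm_per !trp_per.
rewrite opprD addrA -!sumrB; apply: eq_bigr => m _.
by rewrite -!sumrB.
Qed.

Lemma Dxv_pw_poly p g : Dxv xm p g -> exists2 G, pw_poly G g &
  forall m d, (m < M)%N -> (size (G m d) <= p.+1)%N.
Proof.
move=> Dg.
have : forall md : nat * 'I_k, exists P : {poly R}, (md.1 < M)%N ->
   (size P <= p.+1)%N /\ forall x, J md.1 x -> g x md.2 0 = P.[x].
  case=> m d /=; have [mM|mM] := ltnP m M; last by exists 0.
  by have [P [sP gP]] := Dg d m mM; exists P.
move=> /choice[G GP]; exists (fun m d => G (m, d)).
  move=> m mM x Jx; apply/colP => d; rewrite mxE.
  by have [_ ->] := GP (m, d) mM.
by move=> m d mM; have [] := GP (m, d) mM.
Qed.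

Lemma pw_poly_Dxv p g G : pw_poly G g ->
  (forall m d, (m < M)%N -> (size (G m d) <= p.+1)%N) ->
  Dxv xm p g.
Proof.
move=> pG sG d m mM; exists (G m d); split; first exact: sG.
by move=> x Jx; rewrite (pG _ mM)// mxE.
Qed.

(** The sum has at most one nonzero term; it is zero at the nodes. *)
Definition assemble G (x : R) : 'cV[R]_k :=
  \sum_(m < M) (if `[< J m x >] then peval (G m) x else 0).

Lemma pw_poly_assemble G : pw_poly G (assemble G).
Proof.
move=> m mM x Jx; rewrite /assemble (bigD1 (Ordinal mM))//= asboolT// big1 ?addr0//.
move=> i im; rewrite asboolF// => Jx'; move/eqP: im; apply; apply/val_inj => /=.
exact: (xelem_inj _ mM Jx' Jx).
Qed.

(** Assembling elementwise solutions shows that a discrete derivative exists,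
    so the chosen one satisfies the defining identity.  Tested with a
    polynomial placed in one component on one element, that identity is the
    elementwise problem, whose solution is unique. *)
Lemma disc_deriv_pw_poly p W G U : pw_poly W U ->
  (forall d, elem_deriv p (W^~ d) (G^~ d)) ->
  pw_poly G (disc_deriv xm p U).
Proof.
move=> pW dG.
have sG m d : (m < M)%N -> (size (G m d) <= p.+1)%N by move=> /(dG d)[].
have : is_disc_deriv xm p U (disc_deriv xm p U).
  apply: xgetPex; exists (assemble G); split;
    first exact: (pw_poly_Dxv (@pw_poly_assemble G)).
  move=> phi /Dxv_pw_poly[Phi pP sP];
    rewrite (integral_dot_S1 (@pw_poly_assemble G) pP).
  rewrite (disc_rhs pW pP); apply: eq_bigr => m _; apply: eq_bigr => d _.
  by have [_ ->//] := dG d m (ltn_ord m); exact: sP.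
case=> /Dxv_pw_poly[G' pG' sG'] EG'.
suff dG' d : elem_deriv p (W^~ d) (G'^~ d).
  move=> m mM x Jx; rewrite (pG' _ mM)//; apply/colP => d; rewrite !mxE.
  by rewrite (elem_deriv_unique (dG' d) (dG d)).
move=> m mM; split; first exact: sG'.
move=> psi spsi.
pose Phi m' d' : {poly R} := if (m' == m) && (d' == d) then psi else 0.
have sP m' d' : (m' < M)%N -> (size (Phi m' d') <= p.+1)%N.
  by rewrite /Phi; case: ifP; rewrite ?size_poly0.
have := EG' (assemble Phi) (pw_poly_Dxv (@pw_poly_assemble Phi) sP).
rewrite (integral_dot_S1 pG' (@pw_poly_assemble Phi))
  (disc_rhs pW (@pw_poly_assemble Phi)).
have Q (l : nat -> 'I_k -> {poly R} -> R) : (forall m d, l m d 0 = 0) ->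
    \sum_(m' < M) \sum_d' l m' d' (Phi m' d') = l m d psi.
  move=> l0; rewrite (bigD1 (Ordinal mM))//= (bigD1 d)//= /Phi !eqxx/= !big1
    ?addr0//.
    move=> i im; rewrite big1// => d' _; case: eqP => //= im'; rewrite ?l0//.
    by case/eqP: im; exact/val_inj.
  by move=> d' /negPf ->; rewrite l0.
rewrite (Q (fun m d f => pint (nd m) (nd m.+1) (G' m d * f))); last first.
  by move=> *; rewrite mulr0 linear0.
by rewrite (Q (fun m d f => elem_form (W^~ d) m f))// => *; rewrite linear0.
Qed.

(** * The flux of a skew bilinear form *)

Definition bil (A : 'M[R]_k) (F G : 'I_k -> {poly R}) : {poly R} :=
  \sum_d \sum_e A d e *: (F d * G e).

Lemma dot_bil A (F G : 'I_k -> {poly R}) x :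
  dot (peval F x) (A *m peval G x) = (bil A F G).[x].
Proof.
rewrite horner_sum; apply: eq_bigr => d _; rewrite !mxE horner_sum mulr_sumr.
by apply: eq_bigr => e _; rewrite !mxE hornerZ hornerM; ring.
Qed.

Lemma skewE (A : 'M[R]_k) d e : skew_symmetric A -> A d e = - A e d.
Proof. by move=> /matrixP/(_ e d); rewrite !mxE. Qed.

(** The flux [1/2 a_m(U . A V) + 1/2 b_m(U, A V)] in terms of polynomials. *)
Definition skew_flux A (U V : nat -> 'I_k -> {poly R}) m : R :=
  2^-1 * pflux_a (fun i => bil A (U i) (V i)) m +
  2^-1 * \sum_d \sum_e A d e * pflux_b (U^~ d) (V^~ e) m.

Lemma pflux_a_bil A (U V : nat -> 'I_k -> {poly R}) m : pflux_a (fun i =>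
  bil A (U i) (V i)) m =
  \sum_d \sum_e A d e * pflux_a (fun i => U i d * V i e) m.
Proof.
have E (x : R) i : (bil A (U i) (V i)).[x] =
  \sum_d \sum_e A d e * (U i d * V i e).[x].
  by rewrite horner_sum; apply: eq_bigr => d _; rewrite horner_sum;
    apply: eq_bigr => e _; rewrite hornerZ.
rewrite /pflux_a /trm /trp !E -!big_split/= !mulr_sumr -sumrB;
  apply: eq_bigr => d _.
by rewrite -!big_split/= !mulr_sumr -sumrB; apply: eq_bigr => e _; ring.
Qed.

Lemma elem_form_bil A (U V : nat -> 'I_k ->
  {poly R}) c m (phi : {poly R}) : elem_form (fun i => c *: bil A (U i) (V i)) m
    phi =
  c * \sum_d \sum_e A d e * elem_form (fun i => U i d * V i e) m phi.
Proof.
rewrite elem_formZl; congr (_ * _);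
  rewrite (elem_form_suml (fun d i => \sum_e A d e *: (U i d * V i e))).
apply: eq_bigr => d _; rewrite
  (elem_form_suml (fun e i => A d e *: (U i d * V i e))).
by apply: eq_bigr => e _; rewrite elem_formZl.
Qed.

(** Exchanging the two indices in the term with [GV] turns its sign around by
    skew symmetry; each pair of components then contributes the left-hand side
    of [elem_form_flux]. *)
Lemma elem_flux A p (U V GU GV : nat -> 'I_k -> {poly R}) H m : (m < M)%N ->
  skew_symmetric A ->
  (forall d, (size (U m d) <= p.+1)%N) -> (forall d, (size (V m d) <= p.+1)%N) ->
  (forall d, elem_deriv p (U^~ d) (GU^~ d)) ->
    (forall d, elem_deriv p (V^~ d) (GV^~ d)) ->
  elem_deriv p (fun i => 2^-1 *: bil A (U i) (V i)) H ->
  pint (nd m) (nd m.+1)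
    (2^-1 *: bil A (GU m) (V m) - 2^-1 *: bil A (GV m) (U m) + H m) =
  skew_flux A U V m.
Proof.
move=> mM sA sU sV dU dV /(_ m mM)[_ HH].
have := HH 1; rewrite mulr1 size_poly1 => /(_ isT) {}HH.
have E F G : (forall d, (size (G m d) <= p.+1)%N) ->
  forall G', (forall d, elem_deriv p (F^~ d) (G'^~ d)) ->
   pint (nd m) (nd m.+1) (bil A (G' m) (G m)) =
   \sum_d \sum_e A d e * elem_form (F^~ d) m (G m e).
  move=> sG G' dG; rewrite linear_sum; apply: eq_bigr => d _.
  rewrite linear_sum; apply: eq_bigr => e _; rewrite linearZ/=.
  by have [_ ->] := dG d m mM.
rewrite pintD linearB/= !pintZ HH (E _ _ sV _ dU) (E _ _ sU _ dV) elem_form_bil.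
rewrite /skew_flux pflux_a_bil -mulrBr -!mulrDr; congr (_ * _).
rewrite [X in _ - X]exchange_big/= -sumrB -!big_split/=; apply: eq_bigr => d _.
rewrite -sumrB -!big_split/=; apply: eq_bigr => e _.
by rewrite (skewE e d sA) mulNr opprK -!mulrDr elem_form_flux.
Qed.

Lemma pw_poly_mulmx (A : 'M[R]_k) W U : pw_poly W U ->
  pw_poly (fun m d => \sum_e A d e *: W m e) (fun x => A *m U x).
Proof.
move=> pW m mM x Jx; rewrite (pW _ mM)//; apply/colP => d; rewrite !mxE horner_sum.
by apply: eq_bigr => e _; rewrite !mxE hornerZ.
Qed.

Lemma skew_fluxE A W1 W2 U V m : (m < M)%N -> pw_poly W1 U -> pw_poly W2 V ->
  2^-1 * flux_a xm (fun x => dot (U x) (A *m V x)) m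
  + 2^-1 * flux_b xm U (fun x => A *m V x) m = skew_flux A W1 W2 m.
Proof.
move=> mM p1 p2; congr (_ * _ + _ * _).
  have rep i : (i < M)%N -> forall x, J i x ->
      dot (U x) (A *m V x) = (bil A (W1 i) (W2 i)).[x] :> R^o.
    by move=> iM x Jx; rewrite (p1 _ iM)// (p2 _ iM)// dot_bil.
  have cont i : (i < M)%N -> continuous (horner (bil A (W1 i) (W2 i)) : R -> R^o).
    by move=> _; exact: continuous_horner.
  rewrite /flux_a /avg !(trace_minus_rep (V := R^o) _ cont rep) ?(ltnW mM)//.
  by rewrite !(trace_plus_rep (V := R^o) _ cont rep) ?(ltnW mM).
have pA := pw_poly_mulmx A p2.
have sumA (w : nat -> 'I_k -> {poly R}) :
    (forall n, (n <= M)%N -> forall d, trm (fun i => \sum_e A d e *: w i e) n =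
      \sum_e A d e * trm (w^~ e) n) /\
    (forall n, (n <= M)%N -> forall d, trp (fun i => \sum_e A d e *: w i e) n =
      \sum_e A d e * trp (w^~ e) n).
  by split=> n _ d; rewrite /trm /trp horner_sum; apply: eq_bigr => e _;
    rewrite hornerZ.
have [sm sp] := sumA W2.
have dE n : (n <= M)%N ->
   dot (trace_minus xm U n) (trace_plus xm (fun x => A *m V x) n) +
   dot (trace_plus xm U n) (trace_minus xm (fun x => A *m V x) n) =
   \sum_d \sum_e A d e * (trm (W1^~ d) n * trp (W2^~ e) n +
     trp (W1^~ d) n * trm (W2^~ e) n).
  move=> nM; rewrite (trace_minus_pw nM p1) (trace_plus_pw nM p1)
    (trace_minus_pw nM pA) (trace_plus_pw nM pA).
  rewrite /dot -big_split/=; apply: eq_bigr => d _;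
    rewrite !mxE sm// sp// !mulr_sumr.
  by rewrite -big_split/=; apply: eq_bigr => e _; ring.
rewrite /flux_b !dE ?(ltnW mM)// !mulr_sumr -sumrB; apply: eq_bigr => d _.
rewrite !mulr_sumr -sumrB; apply: eq_bigr => e _; rewrite /pflux_b; ring.
Qed.

(** Each flux is a difference of values at two successive nodes, and the values
    at the first and last nodes coincide. *)
Lemma sum_skew_flux A W1 W2 : \sum_(m < M) skew_flux A W1 W2 m = 0.
Proof.
have tel (f : nat -> R) : f M = f 0%N -> \sum_(m < M) (f m.+1 - f m) = 0.
  by move=> fM; rewrite sumrB -sum_periodic ?subrr.
rewrite big_split/= -!mulr_sumr /pflux_a.
rewrite (tel (fun m => 2^-1 * (trm (fun i => bil A (W1 i) (W2 i)) m +
  trp (fun i => bil A (W1 i) (W2 i)) m))); last first.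
  by rewrite trm_per trp_per.
rewrite exchange_big/= big1 ?mulr0 ?addr0// => d _.
rewrite exchange_big/= big1// => e _; rewrite -mulr_sumr /pflux_b.
rewrite (tel (fun m => 2^-1 * (trm (W1^~ d) m * trp (W2^~ e) m +
  trp (W1^~ d) m * trm (W2^~ e) m))) ?mulr0//.
by rewrite !trm_per !trp_per.
Qed.

Lemma continuous_dot (T : topologicalType) (F G : T -> 'cV[R]_k) :
  continuous F -> continuous G -> continuous (fun z => dot (F z) (G z)).
Proof.
move=> cF cG; apply: continuous_big => [|d _ z]; first exact: add_continuous.
have cc (H : T -> 'cV[R]_k) : continuous H ->
  {for z, continuous (fun x => H x d 0)}.
  move=> cH; apply: (@continuous_comp _ _ _ H (fun M : 'cV[R]_k => M d 0)).
    exact: cH.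
  exact: coord_continuous.
by apply: cvgM; exact: cc.
Qed.

End Piecewise.

(** * Polynomials in time with polynomial coefficients in space *)

Section Bivariate.
Context {R : realType}.
Implicit Types (Q B : {poly {poly R}}) (u v : {poly R}).

(** Freezing [x] instead of [t]; this reduces questions about the dependence
    on [t] to ordinary polynomials. *)
Lemma horner_bi Q (t x : R) : Q.[t%:P].[x] = (map_poly (horner_eval x) Q).[t].
Proof. by rewrite -[in RHS](hornerC t x) -/(horner_eval x t%:P) horner_map. Qed.

Lemma horner_bi_sum N Q (t : R) : (size Q <= N)%N ->
  Q.[t%:P] = \sum_(k < N) t ^+ k *: Q`_k.
Proof.
move=> sQ; rewrite (horner_coef_wide _ sQ); apply: eq_bigr => k _.
by rewrite -polyC_exp mulrC mul_polyC.
Qed.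

Lemma derivable_bi Q (t x : R) : derivable (fun s : R => Q.[s%:P].[x]) t 1.
Proof. by under eq_fun do rewrite horner_bi; exact: derivable_horner. Qed.

Lemma derive1_bi Q (t x : R) :
  derive1 (fun s : R => Q.[s%:P].[x]) t = (Q^`()).[t%:P].[x].
Proof. by under eq_fun do rewrite horner_bi;
  rewrite -derivE deriv_map -horner_bi. Qed.

Lemma continuous_bi Q : continuous (fun z : R * R => Q.[z.1%:P].[z.2]).
Proof.
have -> : (fun z : R * R => Q.[z.1%:P].[z.2]) =
    (fun z => \sum_(k < size Q) ('X^k).[z.1] * (Q`_k).[z.2]).
  apply/funext => z; rewrite (horner_bi_sum z.1 (leqnn _)) horner_sum.
  by apply: eq_bigr => k _; rewrite hornerZ hornerXn.
apply: continuous_big => [|k _ z]; first exact: add_continuous.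
apply: cvgM.
  apply: (@continuous_comp _ _ _ (fun z : R * R => z.1) (horner 'X^k));
    first exact: cvg_fst.
  exact: continuous_horner.
apply: (@continuous_comp _ _ _ (fun z : R * R => z.2) (horner Q`_k));
  first exact: cvg_snd.
exact: continuous_horner.
Qed.

Lemma size_horner_bi Q (t : R) (p : nat) : (forall k, size (Q`_k)%R <= p)%N ->
  (size (Q.[t%:P])%R <= p)%N.
Proof.
move=> sQ; rewrite (horner_bi_sum t (leqnn _)) (leq_trans (size_sum _ _ _))//.
apply/bigmax_leqP => k _; exact: leq_trans (size_scale_leq _ _) (sQ _).
Qed.

(** The integral over [x] is again a polynomial in [t]. *)
Lemma pint_bi (a b : R) B (t : R) : pint a b B.[t%:P] = (map_poly (pint a b) B).[t].
Proof.
rewrite (horner_bi_sum t (leqnn _)) linear_sum /=.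
rewrite (horner_coef_wide _ (size_poly _ _)); apply: eq_bigr => k _.
by rewrite linearZ/= coef_map_id0 ?linear0// mulrC.
Qed.

Lemma continuous_pint_bi (a b : R) B : continuous (fun t : R => pint a b B.[t%:P]).
Proof. by under eq_fun do rewrite pint_bi; exact: continuous_horner. Qed.

Definition bint (a b c d : R) B : R := pint a b (map_poly (pint c d) B).

Lemma bintE a b c d B :
  bint a b c d B = \int[leb]_(t in `]a, b[) pint c d B.[t%:P].
Proof. by apply: eq_Rintegral => t _; rewrite pint_bi. Qed.

Lemma bintD a b c d : {morph bint a b c d : B C / B + C}.
Proof.
move=> B C; rewrite /bint -linearD; congr (pint _ _ _); apply/polyP => k.
by rewrite coefD !coef_map_id0 ?linear0// coefD linearD.
Qed.

Lemma bint0 a b c d : bint a b c d 0 = 0.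
Proof. by rewrite /bint map_poly0 linear0. Qed.

Lemma bint_sum a b c d (I : Type) (r : seq I) (P : pred I) (F : I ->
  {poly {poly R}}) :
  bint a b c d (\sum_(i <- r | P i) F i) = \sum_(i <- r | P i) bint a b c d (F i).
Proof.
by apply: (big_morph _ (bintD a b c d) (bint0 a b c d)).
Qed.

(** The tensor product [u(t) v(x)]. *)
Definition ptens u v : {poly {poly R}} := map_poly polyC u * v%:P.

Lemma coef_ptens u v k : (ptens u v)`_k = u`_k *: v.
Proof. by rewrite coefMC coef_map/= mul_polyC. Qed.

Lemma horner_ptens u v (t : R) : (ptens u v).[t%:P] = u.[t] *: v.
Proof. by rewrite hornerM hornerC horner_map/= mul_polyC. Qed.

Lemma size_ptens u v : (size (ptens u v) <= size u)%N.
Proof.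
apply/leq_sizeP => k uk; rewrite coef_ptens nth_default ?scale0r//.
Qed.

Lemma ptensM u v u' v' : ptens u v * ptens u' v' = ptens (u * u') (v * v').
Proof. by rewrite /ptens rmorphM polyCM; ring. Qed.

Lemma ptensBl u u' v : ptens u v - ptens u' v = ptens (u - u') v.
Proof. by rewrite /ptens rmorphB mulrBl. Qed.

Lemma bint_ptens a b c d u v : bint a b c d (ptens u v) = pint a b u * pint c d v.
Proof.
rewrite /bint mulrC -pintZ; congr (pint _ _ _); apply/polyP => k.
by rewrite coef_map_id0 ?linear0// coef_ptens coefZ linearZ/= mulrC.
Qed.

Lemma bi_ptens N Q : (size Q <= N)%N -> Q = \sum_(k < N) ptens 'X^k Q`_k.
Proof.
move=> sQ; apply/polyP => k; rewrite coef_sum.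
under eq_bigr do rewrite coef_ptens coefXn.
have [kN|Nk] := ltnP k N.
  rewrite (bigD1 (Ordinal kN))//= eqxx scale1r big1 ?addr0// => i ik.
  by rewrite [k == i]eq_sym (negPf (_ : nat_of_ord i != k)) ?scale0r//; exact: ik.
rewrite nth_default ?(leq_trans sQ)// big1// => i _.
by rewrite gtn_eqF ?scale0r// (leq_trans (ltn_ord i)).
Qed.

(** Degree less than [N] in time and less than [p] in space. *)
Definition bideg (N p : nat) Q :=
  (size Q <= N)%N /\ forall k, (size (Q`_k)%R <= p)%N.

Lemma bideg_sum N p (I : finType) (F : I -> {poly {poly R}}) :
  (forall i, bideg N p (F i)) -> bideg N p (\sum_i F i).
Proof.
move=> sF; split.
  rewrite (leq_trans (size_sum _ _ _))//; apply/bigmax_leqP => i _.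
  by have [] := sF i.
move=> k; rewrite coef_sum (leq_trans (size_sum _ _ _))//; apply/bigmax_leqP => i _.
by have [] := sF i.
Qed.

Lemma bideg_ptens N p u v : (size u <= N)%N -> (size v <= p)%N ->
  bideg N p (ptens u v).
Proof.
move=> su sv; split; first exact: leq_trans (size_ptens _ _) su.
by move=> k; rewrite coef_ptens (leq_trans (size_scale_leq _ _)).
Qed.

Lemma bideg_scale N p (c : R) Q : bideg N p Q -> bideg N p (c%:P *: Q).
Proof.
move=> [sQ sk]; split; first exact: leq_trans (size_scale_leq _ _) sQ.
by move=> k; rewrite coefZ mul_polyC (leq_trans (size_scale_leq _ _)).
Qed.

Lemma bideg_deriv N p Q : bideg N.+1 p Q -> bideg N p Q^`().
Proof.
move=> [sQ sk]; split.
  apply/leq_sizeP => k Nk; rewrite coef_deriv nth_default ?mul0rn//.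
  exact: leq_trans sQ _.
by move=> k; rewrite coef_deriv -scaler_nat (leq_trans (size_scale_leq _ _)).
Qed.

(** When the spatial degree of [Q] is already admissible, the space-time
    projection acts in time only: it replaces each power of [t] by its
    projection.  Against a tensor product the double integral factors, and the
    factor in time vanishes. *)
Lemma time_proj (a b : R) N p Q : a < b -> (forall k, (size (Q`_k)%R <= p)%N) ->
  exists2 P, bideg N.+1 p P & forall c d B, (size B <= N.+1)%N ->
    bint a b c d ((Q - P) * B) = 0.
Proof.
move=> ab sQ.
have /choice[pi piP] : forall k : nat, exists g : {poly R}, (size g <= N.+1)%N /\
    forall phi : {poly R}, (size phi <= N.+1)%N ->
      pint a b (g * phi) = pint a b ('X^k * phi).
  move=> k; have [|g] := poly_riesz N (l := fun phi => pint a b ('X^k * phi)) ab.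
    by move=> c u v; rewrite mulrDr -scalerAr pintD pintZ.
  by exists g.
exists (\sum_(k < size Q) ptens (pi k) Q`_k).
  apply: bideg_sum => k; apply: bideg_ptens => //.
  by have [] := piP k.
move=> c d B sB; rewrite {1}(bi_ptens (leqnn (size Q))) -sumrB mulr_suml bint_sum
  big1// => k _.
rewrite (bi_ptens sB) mulr_sumr bint_sum big1// => l _.
rewrite ptensBl ptensM bint_ptens mulrBl linearB/=.
by have [_ ->] := piP k; rewrite ?size_polyXn// subrr mul0r.
Qed.

End Bivariate.

(** * Space-time finite element functions as bivariate polynomials *)

Section SpaceTimeReps.
Context {R : realType} (T : R) (tm : mesh 0 T) (xm : mesh (0 : R) 1) (k : nat).
Local Notation M := (nelem xm).
Local Notation nd := (node xm).
Local Notation J := (xelem xm).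
Implicit Types (Q G P W Phi : nat -> 'I_k -> {poly {poly R}}).

Definition at_time Q (t : R) : nat -> 'I_k -> {poly R} := fun m d => (Q m d).[t%:P].

(** On one time element the coefficients in the tensor product can be merged
    into a single bivariate polynomial for each space element. *)
Lemma tensor_bipoly (A B : set R) N p (X : set (R -> R)) (U : R -> R -> 'cV[R]_k) :
  B `<=` A ->
  (forall u, X u -> exists P : {poly R}, (size P <= N)%N /\ forall s, B s ->
    u s = P.[s]) ->
  tensor A X (Dx xm p) U ->
  exists2 Q, (forall m d, bideg N p.+1 (Q m d)) &
    forall t, B t -> pw_poly xm (at_time Q t) (U t).
Proof.
move=> BA XB tU.
suff /choice[Q QP] : forall d, exists Qd : nat -> {poly {poly R}},
    (forall m, bideg N p.+1 (Qd m)) /\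
    forall t, B t -> forall m, (m < M)%N -> forall x, J m x ->
      U t x d 0 = (Qd m).[t%:P].[x].
  exists (fun m d => Q d m) => [m d|t Bt m mM x Jx]; first by have [] := QP d.
  by apply/colP => d; rewrite mxE; have [_ E] := QP d; rewrite (E t Bt m mM x Jx).
move=> d; have [j [u [v [Xu Yv E]]]] := tU d.
have /choice[P PP] := fun i => XB _ (Xu i).
have /choice[V VP] : forall im : 'I_j * nat, exists V : {poly R},
  (size V <= p.+1)%N /\
    ((im.2 < M)%N -> forall x, J im.2 x -> v im.1 x = V.[x]).
  move=> [i m] /=; have [mM|mM] := ltnP m M; last by exists 0; rewrite size_poly0.
  by have [V [sV EV]] := Yv i m mM; exists V.
exists (fun m => \sum_i ptens (P i) (V (i, m))); split.
  move=> m; apply: bideg_sum => i; apply: bideg_ptens.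
    by have [] := PP i.
  by have [] := VP (i, m).
move=> t Bt m mM x Jx; rewrite E; [|exact: BA|exact: (xelem_sub mM Jx)].
rewrite !horner_sum; apply: eq_bigr => i _.
rewrite horner_ptens hornerZ; have [_ ->//] := PP i.
by have [_ ->] := VP (i, m).
Qed.

Lemma assembleE (G0 : nat -> 'I_k -> {poly R}) (x : R) d : assemble xm G0 x d 0 =
  \sum_(m < M) (if `[< J m x >] then (G0 m d).[x] else 0).
Proof.
rewrite /assemble summxE; apply: eq_bigr => m _.
by case: ifP; rewrite !mxE.
Qed.

(** Conversely, piecewise bivariate polynomials are admissible.  The factor [c]
    will be the indicator function of a time element. *)
Lemma tensor_assemble (A : set R) (X : set (R -> R)) N p (c : R -> R) Q :
  (forall l, (l < N)%N -> X (fun t => c t * t ^+ l)) ->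
  (forall m d, bideg N p.+1 (Q m d)) ->
  tensor A X (Dx xm p) (fun t x => c t *: assemble xm (at_time Q t) x).
Proof.
move=> XN sQ d.
exists N, (fun l t => c t * t ^+ l),
  (fun l x => assemble xm (fun m d => (Q m d)`_l) x d 0).
split=> [l|l|t x _ _]; first exact: XN.
  move=> m mM; exists (Q m d)`_l; split; first by have [] := sQ m d.
  by move=> x Jx; rewrite (@pw_poly_assemble _ _ _ _ m mM x Jx) mxE.
rewrite mxE assembleE mulr_sumr.
under [RHS]eq_bigr do rewrite assembleE -mulrA !mulr_sumr.
rewrite exchange_big/=; apply: eq_bigr => m _.
case: ifP => _; last by rewrite mulr0 big1// => l _; rewrite !mulr0.
rewrite /at_time (@horner_bi_sum _ N); last by have [] := sQ m d.
by rewrite horner_sum mulr_sumr; apply: eq_bigr => l _; rewrite hornerZ.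
Qed.

Lemma st_dot_integral n W Phi (U phi : R -> R -> 'cV[R]_k) :
  (forall t, telem tm n t -> pw_poly xm (at_time W t) (U t)) ->
  (forall t, telem tm n t -> pw_poly xm (at_time Phi t) (phi t)) ->
  \int[leb]_(t in telem tm n) \int[leb]_(x in `[0, 1[) dot (U t x) (phi t x) =
  \sum_(m < M) bint (node tm n) (node tm n.+1) (nd m) (nd m.+1)
    (\sum_d W m d * Phi m d).
Proof.
move=> pW pP.
rewrite /telem (@co_integral _ _ _ _
  (horner (\sum_(m < M) map_poly (pint (nd m) (nd m.+1))
    (\sum_d W m d * Phi m d)))).
- by rewrite -linear_sum.
- exact: continuous_horner.
move=> t tI; have tn : telem tm n t by exact: subset_itv_oo_co.
rewrite (integral_dot_S1 (pW _ tn) (pP _ tn)) horner_sum; apply: eq_bigr => m _.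
rewrite -pint_bi horner_sum linear_sum; apply: eq_bigr => d _.
by rewrite hornerM.
Qed.

(** Projecting in time on each space element gives a projection, so the chosen
    one satisfies the orthogonality relation.  Since the test functions may be
    supported in a single space element, this relation holds on each. *)
Lemma st_proj_bipoly n q p (V : R -> R -> 'cV[R]_k) G : (n < nelem tm)%N ->
  (forall t, telem tm n t -> pw_poly xm (at_time G t) (V t)) ->
  (forall m d l, (size ((G m d)`_l)%R <= p.+1)%N) ->
  exists P, [/\ forall m d, bideg q.+1 p.+1 (P m d),
    forall t, telem tm n t -> pw_poly xm (at_time P t) (st_proj tm xm q p n V t) &
    forall m F, (m < M)%N -> (forall d, bideg q.+1 p.+1 (F d)) ->
      bint (node tm n) (node tm n.+1) (nd m) (nd m.+1)
        (\sum_d (G m d - P m d) * F d) = 0].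
Proof.
move=> nT pV sG.
have Xl l : (l < q.+1)%N -> poly_on (telem tm n) q (fun t => 1 * t ^+ l).
  by move=> lq; exists 'X^l; rewrite size_polyXn; split => // s _;
    rewrite hornerXn mul1r.
have sub W1 W2 (U1 U2 : R -> R -> 'cV[R]_k) : (forall t, telem tm n t ->
  pw_poly xm (at_time W1 t) (U1 t)) ->
    (forall t, telem tm n t -> pw_poly xm (at_time W2 t) (U2 t)) ->
    forall t, telem tm n t ->
      pw_poly xm (at_time (fun m d => W1 m d - W2 m d) t) (fun x =>
        U1 t x - U2 t x).
  move=> p1 p2 t tI m mM x Jx; rewrite (p1 _ tI _ mM _ Jx) (p2 _ tI _ mM _ Jx).
  by apply/colP => d; rewrite !mxE /at_time !hornerE.
have : is_st_proj tm xm q p n V (st_proj tm xm q p n V).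
  apply: xgetPex.
  have /choice[P0 P0P] : forall md : nat * 'I_k, exists P : {poly {poly R}},
    bideg q.+1 p.+1 P /\
     forall c d (B : {poly {poly R}}), (size B <= q.+1)%N ->
       bint (node tm n) (node tm n.+1) c d ((G md.1 md.2 - P) * B) = 0.
    move=> [m d]; have [P sP oP] := time_proj q (node_lt nT) (sG m d).
    by exists P.
  pose P1 m d := P0 (m, d).
  have sP1 m d : bideg q.+1 p.+1 (P1 m d) by have [] := P0P (m, d).
  exists (fun t x => 1 *: assemble xm (at_time P1 t) x); split.
    exact: (@tensor_assemble _ _ q.+1 p (cst 1) P1).
  move=> phi /(tensor_bipoly (@subset_refl _ _) (N := q.+1) (fun u Xu =>
    Xu))[Phi sPhi pPhi].
  rewrite (st_dot_integral _ pPhi (W := fun m d => G m d - P1 m d)).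
    rewrite big1// => m _; rewrite bint_sum big1// => d _.
    have [_ ->] := P0P (val m, d); first by [].
    by have [] := sPhi m d.
  apply: sub => // t tI m mM x Jx; rewrite scale1r; exact: pw_poly_assemble.
case=> /(tensor_bipoly (@subset_refl _ _) (N := q.+1) (fun u Xu => Xu))[P sP pP]
  orth.
exists P; split => // m F mM sF.
pose Phi m' d := if m' == m then F d else 0.
have sPhi m' d : bideg q.+1 p.+1 (Phi m' d).
  rewrite /Phi; case: ifP => // _; split; first by rewrite size_poly0.
  by move=> l; rewrite coef0 size_poly0.
have := orth _ (@tensor_assemble _ _ q.+1 p (cst 1) Phi Xl sPhi).
rewrite (st_dot_integral (sub _ _ _ _ pV pP) (Phi := Phi)).
  rewrite (bigD1 (Ordinal mM))//= [X in _ + X]big1 ?addr0.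
    by rewrite /Phi eqxx.
  move=> i im; rewrite bint_sum big1// => d _;
    rewrite /Phi (negPf (_ : val i != m)) ?mulr0 ?bint0//.
move=> t tI m' mM' x Jx; rewrite scale1r; exact: pw_poly_assemble.
Qed.

(** The discrete derivative of a function polynomial in time is taken on the
    coefficients of the powers of [t]. *)
Lemma bielem_deriv_exists p N Q : (forall m d, (size (Q m d) <= N)%N) ->
  exists2 G, (forall m d, bideg N p.+1 (G m d)) &
    forall d l, elem_deriv xm p (fun m => (Q m d)`_l) (fun m => (G m d)`_l).
Proof.
move=> sQ.
have /choice[g gP] : forall dl : 'I_k * nat, exists g : nat -> {poly R},
    elem_deriv xm p (fun m => (Q m dl.1)`_dl.2) g /\ forall m,
      (size (g m) <= p.+1)%N.
  by move=> [d l]; have [g dg sg] :=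
    elem_deriv_exists xm p (fun m => (Q m d)`_l); exists g.
exists (fun m d => \poly_(l < N) g (d, l) m).
  move=> m d; split; first exact: size_poly.
  move=> l; rewrite coef_poly; case: ifP => _; last by rewrite size_poly0.
  by have [] := gP (d, l).
move=> d l; under [X in elem_deriv _ _ _ X]eq_fun do rewrite coef_poly.
case: ltnP => [_|Nl]; first by have [] := gP (d, l).
rewrite (_ : (fun m => _) = fun=> 0); first exact: elem_deriv0.
by apply/funext => m; rewrite nth_default// (leq_trans (sQ _ _)).
Qed.

Lemma elem_deriv_at_time p N Q G t d : (forall m d, (size (Q m d) <= N)%N) ->
  (forall m d, (size (G m d) <= N)%N) ->
  (forall d l, elem_deriv xm p (fun m => (Q m d)`_l) (fun m => (G m d)`_l)) ->
  elem_deriv xm p ((at_time Q t)^~ d) ((at_time G t)^~ d).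
Proof.
move=> sQ sG dQ.
have E (P : nat -> 'I_k -> {poly {poly R}}) : (forall m d, (size (P m d) <= N)%N) ->
    (at_time P t)^~ d = fun m => \sum_(l < N) t ^+ l *: (P m d)`_l.
  by move=> sP; apply/funext => m; rewrite /at_time (horner_bi_sum t (sP m d)).
rewrite !E//.
exact: (@elem_deriv_sum _ _ _ N (fun l => t ^+ l) (fun l m =>
  (Q m d)`_l) (fun l m => (G m d)`_l)).
Qed.

(** Discrete derivative in space and derivative in time commute. *)
Lemma bielem_deriv_dt p Q G :
  (forall d l, elem_deriv xm p (fun m => (Q m d)`_l) (fun m => (G m d)`_l)) ->
  (forall d l, elem_deriv xm p (fun m => (Q m d)^`()`_l) (fun m => (G m d)^`()`_l)).
Proof.
move=> dQ d l.
have E (P : nat -> 'I_k -> {poly {poly R}}) : (fun m => (P m d)^`()`_l) =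
    fun m => l.+1%:R *: (P m d)`_l.+1 + 0.
  by apply/funext => m; rewrite coef_deriv addr0 scaler_nat.
by rewrite !E; exact: (elem_deriv_lin l.+1%:R (dQ d l.+1) (@elem_deriv0 _ xm p)).
Qed.

Lemma disc_deriv1_pw_poly p (f : R -> R) (w H : nat -> {poly R}) :
  (forall m, (m < M)%N -> forall x, J m x -> f x = (w m).[x]) ->
    elem_deriv xm p w H ->
  forall m, (m < M)%N -> forall x, J m x -> disc_deriv1 xm p f x = (H m).[x].
Proof.
move=> fw dH m mM x Jx.
have pf : pw_poly xm (fun m (_ : 'I_1) => w m) (fun y => (f y)%:M : 'cV[R]_1).
  move=> i iM y Jy; apply/colP => d; rewrite !mxE (fw _ iM)//.
  by rewrite [d]ord1 mulr1n.
by rewrite /disc_deriv1 (disc_deriv_pw_poly pf (G := fun m (_ : 'I_1) =>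
  H m) _ mM Jx)// mxE.
Qed.

Definition bbil (A : 'M[R]_k) (F G : 'I_k -> {poly {poly R}}) : {poly {poly R}} :=
  \sum_d \sum_e (A d e)%:P *: (F d * G e).

Lemma bbilE A (F G : 'I_k -> {poly {poly R}}) (t : R) :
  (bbil A F G).[t%:P] = bil A (fun d => (F d).[t%:P]) (fun d => (G d).[t%:P]).
Proof.
rewrite horner_sum; apply: eq_bigr => d _; rewrite horner_sum;
  apply: eq_bigr => e _.
by rewrite hornerZ hornerM mul_polyC.
Qed.

Lemma deriv_bbil A (F G : 'I_k -> {poly {poly R}}) : (bbil A F G)^`() =
  bbil A (fun d => (F d)^`()) G + bbil A F (fun d => (G d)^`()).
Proof.
rewrite -big_split linear_sum; apply: eq_bigr => d _ /=.
rewrite -big_split linear_sum; apply: eq_bigr => e _ /=.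
by rewrite derivZ derivM scalerDr.
Qed.

(** The product of a matrix with a vector of bivariate polynomials; it turns
    the form [bbil A] into a test against [bmul A G]. *)
Definition bmul (A : 'M[R]_k) (F : 'I_k -> {poly {poly R}}) d : {poly {poly R}} :=
  \sum_e (A d e)%:P *: F e.

Lemma bideg_bmul A N p (F : 'I_k -> {poly {poly R}}) d :
  (forall e, bideg N p (F e)) -> bideg N p (bmul A F d).
Proof. by move=> sF; apply: bideg_sum => e; exact: bideg_scale. Qed.

Lemma sum_bmul A (F G : 'I_k -> {poly {poly R}}) :
  \sum_d F d * bmul A G d = bbil A F G.
Proof.
apply: eq_bigr => d _; rewrite mulr_sumr; apply: eq_bigr => e _.
by rewrite -scalerAr.
Qed.

Lemma bbilBl A (F F' G : 'I_k -> {poly {poly R}}) :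
  bbil A (fun d => F d - F' d) G = bbil A F G - bbil A F' G.
Proof.
rewrite -!sum_bmul -sumrB; apply: eq_bigr => d _; exact: mulrBl.
Qed.

Lemma continuous_skew_flux A Q G m : continuous (fun t : R =>
  skew_flux xm A (at_time Q t) (at_time G t) m).
Proof.
have cb (B : {poly {poly R}}) (x : R) : continuous (fun t : R => B.[t%:P].[x]).
  by under eq_fun do rewrite horner_bi; exact: continuous_horner.
have cd i x : continuous (fun t : R => (bil A (at_time Q t i) (at_time G t i)).[x]).
  by under eq_fun do rewrite -bbilE; exact: cb.
have csum (F : 'I_k -> R -> R) : (forall d, continuous (F d)) ->
  continuous (fun t => \sum_d F d t).
  by move=> cF; apply: continuous_big => //; exact: add_continuous.
have cZ (c : R) (f : R -> R) : continuous f -> continuous (fun t => c * f t).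
  by move=> cf t; apply: cvgM; [exact: cvg_cst|exact: cf].
have cM (f g : R -> R) : continuous f -> continuous g ->
  continuous (fun t => f t * g t).
  by move=> cf cg t; apply: cvgM; [exact: cf|exact: cg].
have cD (f g : R -> R) : continuous f -> continuous g ->
  continuous (fun t => f t + g t).
  by move=> cf cg t; apply: cvgD; [exact: cf|exact: cg].
have cB (f g : R -> R) : continuous f -> continuous g ->
  continuous (fun t => f t - g t).
  by move=> cf cg t; apply: cvgB; [exact: cf|exact: cg].
apply: (cD); apply: (cZ).
  by apply: (cB); apply: (cZ); apply: (cD); exact: cd.
apply: (csum) => d; apply: (csum) => e; apply: (cZ).
by apply: (cB); apply: (cZ); apply: (cD); apply: (cM); exact: cb.
Qed.

Lemma continuous_peval_at (F : 'I_k -> {poly {poly R}}) :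
  continuous (fun z : R * R => peval (fun d => (F d).[z.1%:P]) z.2).
Proof.
apply: continuous_cV => d;
  rewrite (_ : (fun _ => _) = fun z : R * R => (F d).[z.1%:P].[z.2]).
  exact: continuous_bi.
by apply/funext => z; rewrite mxE.
Qed.

(** * The potential along a discrete solution *)

Section Potential.
Variables (S : 'cV[R]_k -> R) (S_C1 : C1 S).

Definition grad_pair (F G : 'I_k -> {poly {poly R}}) t x : R :=
  dot (grad S (peval (fun d => (F d).[t%:P]) x)) (peval (fun d => (G d).[t%:P]) x).

Lemma continuous_grad_pair (F G : 'I_k ->
  {poly {poly R}}) : continuous (fun z : R * R => grad_pair F G z.1 z.2).
Proof.
apply: continuous_dot; last exact: continuous_peval_at.
move=> z; apply: (@continuous_comp _ _ _ (fun z : R * R =>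
  peval (fun d => (F d).[z.1%:P]) z.2) (grad S)).
  exact: continuous_peval_at.
exact: S_C1.2.
Qed.

Lemma derivable_peval_at (F : 'I_k -> {poly {poly R}}) (t x : R) :
  derivable (fun s : R => peval (fun d => (F d).[s%:P]) x) t 1.
Proof.
apply/derivable_mxP => d j;
  rewrite (_ : (fun _ => _) = fun s : R => (F d).[s%:P].[x]).
  exact: derivable_bi.
by apply/funext => s; rewrite mxE.
Qed.

Lemma derive1_peval_at (F : 'I_k -> {poly {poly R}}) (t x : R) :
  derive1 (fun s : R => peval (fun d => (F d).[s%:P]) x) t =
  peval (fun d => (F d)^`().[t%:P]) x.
Proof.
rewrite derive1E derive_mx; last exact: derivable_peval_at.
apply/colP => d; rewrite !mxE -derive1_bi derive1E.
have -> : (fun s : R => peval (fun d0 : 'I_k => (F d0).[s%:P]) x d 0) = fun s =>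
  (F d).[s%:P].[x].
  by apply/funext => s; rewrite mxE.
by [].
Qed.

Lemma derive_potential (F : 'I_k -> {poly {poly R}}) (t x : R) :
  derivable (fun s : R => S (peval (fun d => (F d).[s%:P]) x)) t 1 /\
  derive1 (fun s : R => S (peval (fun d => (F d).[s%:P]) x)) t =
  grad_pair F (fun d => (F d)^`()) t x.
Proof.
set g := fun s : R => peval (fun d => (F d).[s%:P]) x.
have dg : differentiable g t by apply/derivable1_diffP/derivable_peval_at.
have dS := S_C1.1 (g t).
have dc : differentiable (S \o g) t by exact: differentiable_comp.
split; first exact/derivable1_diffP.
rewrite (_ : (fun _ => _) = S \o g)// derive1E' // diff_comp//=.
rewrite -derive1E'// derive1_peval_at.
set v := peval _ _.
rewrite [v in LHS](_ : v = \sum_d v d 0 *: (delta_mx d 0 : 'cV[R]_k)); last first.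
  by rewrite [LHS]matrix_sum_delta; apply: eq_bigr => d _; rewrite big_ord1.
rewrite linear_sum; apply: eq_bigr => d _.
by rewrite linearZ /= [grad _ _ d 0]mxE deriveE// mulrC.
Qed.

End Potential.

End SpaceTimeReps.

(** * The method on one space-time element *)

Section Laws.
Context {R : realType} (T : R) (tm : mesh 0 T) (xm : mesh (0 : R) 1) (k : nat).
Local Notation M := (nelem xm).
Local Notation nd := (node xm).
Local Notation J := (xelem xm).
Implicit Types (F G : 'I_k -> {poly {poly R}}).

Lemma bbil_skew (A : 'M[R]_k) F G : skew_symmetric A -> bbil A F G = - bbil A G F.
Proof.
move=> sA; rewrite /bbil exchange_big/= -sumrN; apply: eq_bigr => d _.
rewrite -sumrN; apply: eq_bigr => e _.
by rewrite (skewE _ _ sA) polyCN scaleNr mulrC.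
Qed.

Lemma bbil_alt (A : 'M[R]_k) F : skew_symmetric A -> bbil A F F = 0.
Proof.
move=> sA; have e := bbil_skew F F sA.
have h : (1 : R) = 2^-1 + 2^-1 by rewrite [LHS]splitr mul1r.
rewrite -[LHS]scale1r -polyC1 h polyCD scalerDl {2}e scalerN.
exact: subrr.
Qed.

Lemma dt_eq (V : normedModType R) (f : R -> R -> V) (F : R -> V) a b (t x : R) :
  t \in `]a, b[ -> (forall s, s \in `]a, b[ -> f s x = F s) ->
  dt f t x = derive1 F t.
Proof.
move=> tI fF; rewrite /dt !derive1E; apply: near_eq_derive.
have : open `]a, b[%classic by exact: interval_open.
rewrite openE => /(_ t); rewrite /= tI => /(_ isT).
by apply: filterS => s /fF.
Qed.

Lemma integral_oo_sum N (f : nat -> R -> R) (a b : R) :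
  (forall m, (m < N)%N -> continuous (f m)) ->
  continuous (fun t => \sum_(m < N) f m t) /\
  \int[leb]_(t in `]a, b[) \sum_(m < N) f m t =
  \sum_(m < N) \int[leb]_(t in `]a, b[) f m t.
Proof.
elim: N => [_|N IH cf].
  rewrite big_ord0; split.
    by under eq_fun do rewrite big_ord0; exact: cst_continuous.
  under eq_Rintegral do rewrite big_ord0.
  by rewrite -[X in \int[leb]_(_ in _) X](mulr0 0) integral_ooZ ?mul0r//;
    exact: cst_continuous.
have [cI EI] := IH (fun m mN => cf m (ltnW mN)).
split.
  under eq_fun do rewrite big_ord_recr/=.
  by move=> t; apply: cvgD; [exact: cI|exact: cf].
under eq_Rintegral do rewrite big_ord_recr/=.
by rewrite integral_ooD// ?EI ?big_ord_recr//; exact: cf.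
Qed.

(** If the integral of a density over each space element is a flux plus a
    remainder of zero mean in time, then integrating in time gives the local
    law; summing over the elements first gives the global one, as the fluxes
    cancel. *)
Lemma laws_of_elem_identity n (e : R -> R -> R) (c : R -> nat -> R ->
  R) (fl rho : nat -> R -> R) :
  (forall t, t \in `]node tm n, node tm n.+1[ -> forall m, (m < M)%N ->
    [/\ continuous (c t m), forall x, J m x -> e t x = c t m x &
        \int[leb]_(x in J m) c t m x = fl m t + rho m t]) ->
  (forall m, (m < M)%N -> continuous (fl m)) ->
  (forall m, (m < M)%N -> continuous (rho m)) ->
  (forall m, (m < M)%N -> \int[leb]_(t in `]node tm n, node tm n.+1[) rho m t =
    0) ->
  (forall t, \sum_(m < M) fl m t = 0) ->
  \int[leb]_(t in telem tm n) \int[leb]_(x in `[0, 1[) e t x = 0 /\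
  forall m, (m < M)%N ->
    \int[leb]_(t in telem tm n) \int[leb]_(x in J m) e t x =
    \int[leb]_(t in `]node tm n, node tm n.+1[) fl m t.
Proof.
move=> ec cfl crho rho0 fl0.
have Je t m : t \in `]node tm n, node tm n.+1[ -> (m < M)%N ->
    \int[leb]_(x in J m) e t x = fl m t + rho m t.
  move=> tI mM; have [_ ecx <-] := ec t tI m mM.
  by apply: eq_Rintegral => x; rewrite inE; exact: ecx.
split.
  have [cs Es] := integral_oo_sum (node tm n) (node tm n.+1) crho.
  rewrite /telem (@co_integral _ _ _ _ _ cs).
    by rewrite Es big1// => m _; exact: rho0.
  move=> t tI; rewrite (integral_S1 (xm := xm)).
    under eq_bigr do rewrite (Je t _ tI (ltn_ord _)).
    by rewrite big_split/= fl0 add0r.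
  by move=> m mM; have [cc ecx _] := ec t tI m mM; exists (c t m).
move=> m mM; rewrite /telem (@co_integral _ _ _ _ (fun t => fl m t + rho m t)).
- by rewrite integral_ooD ?rho0 ?addr0//; [exact: cfl|exact: crho].
- by move=> t; apply: cvgD; [exact: cfl|exact: crho].
- by move=> t tI; exact: Je.
Qed.

Context (K L : 'M[R]_k).
Context (S : 'cV[R]_k -> R) (S_C1 : C1 S) (q p : nat).

Lemma continuous_int_grad_pair m F G :
  continuous (fun t => \int[leb]_(x in J m) grad_pair S F G t x).
Proof. by apply: continuous_param; exact: continuous_grad_pair. Qed.

Lemma continuous_grad_pair_x F G t : continuous (grad_pair S F G t).
Proof. by apply: (continuous_slicel (h := grad_pair S F G));
  exact: continuous_grad_pair. Qed.

Lemma Dt_indicator n l : (n < nelem tm)%N -> (l < q.+1)%N ->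
  Dt tm q (fun t => (if `[< telem tm n t >] then 1 else 0) * t ^+ l).
Proof.
move=> nT lq n' nT'; exists (if n' == n then 'X^l else 0); split.
  by case: ifP => _; rewrite ?size_polyXn ?size_poly0.
move=> s sI; case: eqVneq => [<-|nn'].
  by rewrite asboolT// mul1r hornerXn.
rewrite horner0 asboolF ?mul0r// => sn; case/eqP: nn'.
exact: (@mesh_inj _ _ _ tm _ _ s).
Qed.

Definition on_elem m F : nat -> 'I_k -> {poly {poly R}} := fun m' d =>
  if m' == m then F d else 0.

Lemma assemble_on_elem m F (t x : R) : (m < M)%N -> ~ J m x ->
  assemble xm (at_time (on_elem m F) t) x = 0.
Proof.
move=> mM Jx; rewrite /assemble big1// => m' _.
case: asboolP => // Jx'; apply/colP => d; rewrite !mxE /at_time /on_elem.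
by case: eqVneq => [mm'|]; [rewrite mm' in Jx'|rewrite !horner0].
Qed.

(** Testing with [F] cut off outside the space-time element. *)
Lemma method_residual (Z Zt GZ : R -> R -> 'cV[R]_k) n m
    (Q U G : nat -> 'I_k -> {poly {poly R}}) F :
  (n < nelem tm)%N -> (m < M)%N ->
  (forall t, t \in `]node tm n, node tm n.+1[ -> [/\ pw_poly xm (at_time Q t) (Z t),
    pw_poly xm (at_time U t) (Zt t) & pw_poly xm (at_time G t) (GZ t)]) ->
  (forall d, bideg q.+1 p.+1 (F d)) ->
  (forall phi : R -> R -> 'cV[R]_k,
     tensor `[0, T] (Dt tm q) (Dx xm p) phi ->
     \int[leb]_(t in `[0, T]) \int[leb]_(x in `[0, 1[)
       (dot (K *m Zt t x) (phi t x) + dot (L *m GZ t x) (phi t x)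
        - dot (grad S (Z t x)) (phi t x)) = 0) ->
  \int[leb]_(t in `]node tm n, node tm n.+1[)
    (pint (nd m) (nd m.+1) (bbil K F (U m) + bbil L F (G m)).[t%:P]
     - \int[leb]_(x in J m) grad_pair S (Q m) F t x) = 0.
Proof.
move=> nT mM rep sF method.
have dotC (u v : 'cV[R]_k) : dot u v = dot v u.
  by apply: eq_bigr => d _; rewrite mulrC.
have dot0 (u : 'cV[R]_k) : dot u 0 = 0.
  by rewrite /dot big1// => d _; rewrite mxE mulr0.
pose phi t x := (if `[< telem tm n t >] then 1 else 0) *: assemble xm
  (at_time (on_elem m F) t) x.
have /method : tensor `[0, T] (Dt tm q) (Dx xm p) phi.
  apply: (@tensor_assemble _ xm _ _ _ q.+1) => [l lq|m' d];
    first exact: Dt_indicator.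
  rewrite /on_elem; case: ifP => // _; split=> [|l]; first by rewrite size_poly0.
  by rewrite coef0 size_poly0.
rewrite (Rintegral_sub (A := telem tm n)); first last.
- move=> t _ tn; under eq_Rintegral do rewrite /phi asboolF// scale0r !dot0 subr0
  addr0.
  by rewrite Rintegral_cst ?mul0r.
- by apply: (subset_trans (mesh_sub nT)); exact: subset_itv_co_cc.
rewrite /telem (@co_integral _ _ _ _ (fun t =>
  pint (nd m) (nd m.+1) (bbil K F (U m) + bbil L F (G m)).[t%:P]
     - \int[leb]_(x in J m) grad_pair S (Q m) F t x))//.
  move=> t; apply: cvgB; first exact: continuous_pint_bi.
  exact: continuous_int_grad_pair.
move=> t tI; have tn : telem tm n t by exact: subset_itv_oo_co.
have [rZ rU rG] := rep t tI.
rewrite (Rintegral_sub (A := J m)); first last.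
- by move=> x _ Jx; rewrite /phi assemble_on_elem// scaler0 !dot0 subr0 addr0.
- exact: xelem_sub.
rewrite /pint -integral_ooB; first last.
- exact: continuous_grad_pair_x.
- exact: continuous_horner.
apply: eq_Rintegral => x; rewrite inE => Jx.
rewrite (rZ _ mM _ Jx) (rU _ mM _ Jx) (rG _ mM _ Jx) /phi asboolT// scale1r.
rewrite (@pw_poly_assemble _ _ _ _ m mM x Jx).
have -> : at_time (on_elem m F) t m = fun d => (F d).[t%:P].
  by apply/funext => d; rewrite /at_time /on_elem eqxx.
by rewrite !(dotC (_ *m _)) !dot_bil !hornerD !bbilE.
Qed.

End Laws.

(** * The local and global conservation laws *)

Theorem theorem4p7 (R : realType) (T : R) (T_gt0 : 0 < T)
    (D : nat) (D_ge2 : (2 <= D)%N)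
    (K L : 'M[R]_D) (K_skew : skew_symmetric K) (L_skew : skew_symmetric L)
    (S : 'cV[R]_D -> R) (S_C1 : C1 S)
    (tm : mesh 0 T) (xm : mesh (0 : R) 1) (q p : nat)
    (z0 : R -> 'cV[R]_D) (z0_L2 : square_integrable z0)
    (Z : R -> R -> 'cV[R]_D)
    (Z_space : tensor `[0, T] (Ct tm q.+1) (Dx xm p) Z) :
  let Zt := dt Z in
  let GZ := fun t => disc_deriv xm p (Z t) in
  (forall phi : R -> R -> 'cV[R]_D,
     tensor `[0, T] (Dt tm q) (Dx xm p) phi ->
     \int[leb]_(t in `[0, T]) \int[leb]_(x in `[0, 1[)
       (dot (K *m Zt t x) (phi t x) + dot (L *m GZ t x) (phi t x)
        - dot (grad S (Z t x)) (phi t x)) = 0) ->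
  (forall m x, (m < nelem xm)%N -> xelem xm m x -> Z 0 x = proj0 xm p z0 x) ->
  let W n t x := dot (grad S (Z t x)) (st_proj tm xm q p n GZ t x) in
  let Fm t x := 2^-1 * dot (Zt t x) (K *m Z t x) - S (Z t x) in
  let Gm t x := 2^-1 * dot (GZ t x) (K *m Z t x) in
  let Fe t x := 2^-1 * dot (Zt t x) (L *m Z t x) in
  let Ge t x := 2^-1 * dot (GZ t x) (L *m Z t x) + S (Z t x) in
  let momentum n t x :=
    dt (Gm : R -> R -> R^o) t x
    + disc_deriv1 xm p (fun y => Fm t y + S (Z t y)) x - W n t x in
  let energy t x := dt (Ge : R -> R -> R^o) t x + disc_deriv1 xm p (Fe t) x in
  forall n, (n < nelem tm)%N ->
  [/\ \int[leb]_(t in telem tm n) \int[leb]_(x in `[0, 1[) momentum n t x = 0,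
      \int[leb]_(t in telem tm n) \int[leb]_(x in `[0, 1[) energy t x = 0 &
      forall m, (m < nelem xm)%N ->
        \int[leb]_(t in telem tm n) \int[leb]_(x in xelem xm m)
          momentum n t x =
        \int[leb]_(t in telem tm n)
          (2^-1 * flux_a xm (fun x => dot (Zt t x) (K *m Z t x)) m
           + 2^-1 * flux_b xm (Zt t) (fun x => K *m Z t x) m)
        /\
        \int[leb]_(t in telem tm n) \int[leb]_(x in xelem xm m) energy t x =
        \int[leb]_(t in telem tm n)
          (2^-1 * flux_a xm (fun x => dot (Zt t x) (L *m Z t x)) m
           + 2^-1 * flux_b xm (Zt t) (fun x => L *m Z t x) m)].
Proof.
move=> Zt GZ method _ W Fm Gm Fe Ge momentum energy n nT.
set a := node tm n; set b := node tm n.+1.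
have subT : telem tm n `<=` `[0, T]%classic.
  by apply: (subset_trans (mesh_sub nT)); exact: subset_itv_co_cc.
have [Q sQ rQ] : exists2 Q, (forall m d, bideg q.+2 p.+1 (Q m d)) &
    forall t, telem tm n t -> pw_poly xm (at_time Q t) (Z t).
  by apply: (tensor_bipoly subT _ Z_space) => u [/(_ n nT)].
(* Below, Q, G, U and GU stand for Z, G(Z), Z_t and G(Z_t); P will stand for
   the projection of G(Z). *)
have szQ m d : (size (Q m d) <= q.+2)%N by have [] := sQ m d.
have [G sG dG] := bielem_deriv_exists xm p szQ.
have szG m d : (size (G m d) <= q.+2)%N by have [] := sG m d.
pose U m d := (Q m d)^`(); pose GU m d := (G m d)^`().
have sU m d : bideg q.+1 p.+1 (U m d) by exact: bideg_deriv.
have rG t : telem tm n t -> pw_poly xm (at_time G t) (GZ t).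
  move=> tI; apply: disc_deriv_pw_poly (rQ t tI) _ => d;
    exact: (elem_deriv_at_time t d szQ szG dG).
have oI t : t \in `]a, b[ -> telem tm n t by exact: subset_itv_oo_co.
(* At interior times a neighbourhood of t lies in the same time element. *)
have rU t : t \in `]a, b[ -> pw_poly xm (at_time U t) (Zt t).
  move=> tI m mM x Jx.
  rewrite /Zt (dt_eq (F := fun s : R => peval (fun d => (Q m d).[s%:P]) x) tI).
    exact: derive1_peval_at.
  by move=> s /oI sI; exact: rQ.
have [P [sP rP oP]] := st_proj_bipoly q nT rG (fun m d l => (sG m d).2 l).
have dU t d : elem_deriv xm p ((at_time U t)^~ d) ((at_time GU t)^~ d).
  apply: (elem_deriv_at_time (N := q.+1)) => [m i|m i|];
    last exact: bielem_deriv_dt.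
    by have [] := sU m i.
  by have [] := bideg_deriv (sG m i).
have dQ t d : elem_deriv xm p ((at_time Q t)^~ d) ((at_time G t)^~ d) by exact:
  elem_deriv_at_time dG.
have sUt t m d : (size (at_time U t m d) <= p.+1)%N.
  by apply: size_horner_bi; have [] := sU m d.
have sQt t m d : (size (at_time Q t m d) <= p.+1)%N.
  by apply: size_horner_bi; have [] := sQ m d.
have Hex A : exists H : R -> nat -> {poly R}, forall t,
    elem_deriv xm p (fun i => 2^-1 *: bil A (at_time U t i) (at_time Q t i)) (H t).
  suff /choice[H HP] : forall t, exists h,
    elem_deriv xm p (fun i => 2^-1 *: bil A (at_time U t i) (at_time Q t i)) h.
    by exists H.
  move=> t; by have [h dh _] :=
    elem_deriv_exists xm p (fun i =>
      2^-1 *: bil A (at_time U t i) (at_time Q t i)); exists h.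
have localA A : skew_symmetric A ->
  forall (H : R -> nat -> {poly R}) t m, (m < nelem xm)%N ->
    elem_deriv xm p (fun i => 2^-1 *: bil A (at_time U t i) (at_time Q t i))
      (H t) ->
    pint (node xm m) (node xm m.+1) (2^-1 *: bil A (at_time GU t m) (at_time Q t m)
      - 2^-1 *: bil A (at_time G t m) (at_time U t m) + H t m) =
        skew_flux xm A (at_time U t) (at_time Q t) m.
  move=> sA H t m mM; exact: (elem_flux mM sA (sUt t m) (sQt t m) (dU t) (dQ t)).
(* The time derivative of the quadratic part of either density. *)
have DA A (t : R) m x : derive1 (fun s : R =>
  2^-1 * (bil A (at_time G s m) (at_time Q s m)).[x]) t =
    (2^-1 *: bil A (at_time GU t m) (at_time Q t m) +
      2^-1 *: bil A (at_time G t m) (at_time U t m)).[x]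
    /\ derivable (fun s : R =>
      2^-1 * (bil A (at_time G s m) (at_time Q s m)).[x]) t 1.
  pose B := (2^-1)%:P *: bbil A (G m) (Q m).
  have BE : (fun s : R => 2^-1 * (bil A (at_time G s m) (at_time Q s m)).[x]) =
    fun s => B.[s%:P].[x].
    by apply/funext => s; rewrite hornerZ mul_polyC hornerZ bbilE.
  rewrite BE derive1_bi; split; last exact: derivable_bi.
  by rewrite derivZ deriv_bbil hornerZ hornerD mul_polyC scalerDr !bbilE.
have dotE A t m x : t \in `]a, b[ -> (m < nelem xm)%N -> xelem xm m x ->
    [/\ dot (GZ t x) (A *m Z t x) = (bil A (at_time G t m) (at_time Q t m)).[x] &
     dot (Zt t x) (A *m Z t x) = (bil A (at_time U t m) (at_time Q t m)).[x]].
  move=> tI mM Jx; rewrite (rG _ (oI _ tI) _ mM _ Jx) (rQ _ (oI _ tI) _ mM _ Jx).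
  by rewrite (rU _ tI _ mM _ Jx) !dot_bil.
have fluxE A m : (m < nelem xm)%N ->
    \int[leb]_(t in telem tm n)
      (2^-1 * flux_a xm (fun x => dot (Zt t x) (A *m Z t x)) m
       + 2^-1 * flux_b xm (Zt t) (fun x => A *m Z t x) m) =
    \int[leb]_(t in `]a, b[) skew_flux xm A (at_time U t) (at_time Q t) m.
  move=> mM; rewrite /telem
    (@co_integral _ _ _ _ (fun t =>
      skew_flux xm A (at_time U t) (at_time Q t) m))//.
    exact: continuous_skew_flux.
  by move=> t tI; apply: skew_fluxE => //; [exact: rU|exact/rQ/oI].
have reps t : t \in `]a, b[ ->
  [/\ pw_poly xm (at_time Q t) (Z t), pw_poly xm (at_time U t) (Zt t) &
    pw_poly xm (at_time G t) (GZ t)].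
  by move=> tI; split; [exact/rQ/oI|exact: rU|exact/rG/oI].
have [mom1 mom2] : \int[leb]_(t in telem tm n)
  \int[leb]_(x in `[0, 1[) momentum n t x = 0 /\
    forall m, (m < nelem xm)%N ->
      \int[leb]_(t in telem tm n) \int[leb]_(x in xelem xm m) momentum n t x =
    \int[leb]_(t in `]a, b[) skew_flux xm K (at_time U t) (at_time Q t) m.
  have [H dH] := Hex K.
  (* What is left of the density besides the flux: G(Z) . K Z_t - W. *)
  pose rho m t := pint (node xm m) (node xm m.+1) (bbil K (G m) (U m)).[t%:P]
    - \int[leb]_(x in xelem xm m) grad_pair S (Q m) (P m) t x.
  have crho m : continuous (rho m).
    move=> t; apply: cvgB; first exact: continuous_pint_bi.
    exact: continuous_int_grad_pair.
  apply: (@laws_of_elem_identity _ _ _ _ _ _ (fun t m x =>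
    (2^-1 *: bil K (at_time GU t m) (at_time Q t m)
      - 2^-1 *: bil K (at_time G t m) (at_time U t m) + H t m +
        bil K (at_time G t m) (at_time U t m)).[x]
      - grad_pair S (Q m) (P m) t x) _ rho); last first.
  - by move=> t; exact: sum_skew_flux.
  - move=> m mM.
    (* The defect of the projection, tested with K Z_t and with L P(G(Z));
       the remaining terms form the residual tested with P(G(Z)). *)
    pose B2 := bbil K (fun d => G m d - P m d) (U m) +
      bbil L (fun d => G m d - P m d) (P m).
    have E t : rho m t =
      (pint (node xm m) (node xm m.+1) (bbil K (P m) (U m) +
        bbil L (P m) (G m)).[t%:P]
      - \int[leb]_(x in xelem xm m) grad_pair S (Q m) (P m) t x) +
        pint (node xm m) (node xm m.+1) B2.[t%:P].
      rewrite /rho addrAC -pintD -hornerD; congr (pint _ _ _.[_] - _).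
      rewrite /B2 !bbilBl (bbil_alt _ L_skew) (bbil_skew (G m) (P m) L_skew).
      by ring.
    under eq_Rintegral do rewrite E.
    rewrite integral_ooD; first last.
    - exact: continuous_pint_bi.
    - move=> t; apply: cvgB; first exact: continuous_pint_bi.
      exact: continuous_int_grad_pair.
    rewrite (method_residual S_C1 nT mM reps (sP m) method) add0r -bintE.
    rewrite /B2 -!sum_bmul bintD !oP ?addr0// => d; apply: bideg_bmul => e.
      exact: sP.
    exact: sU.
  - by move=> m _; exact: crho.
  - by move=> m _; exact: continuous_skew_flux.
  move=> t tI m mM; split.
  - move=> x; apply: cvgB; first exact: continuous_horner.
    exact: continuous_grad_pair_x.
  - move=> x Jx; rewrite /momentum.
    rewrite (disc_deriv1_pw_poly (w := fun i =>
      2^-1 *: bil K (at_time U t i) (at_time Q t i)) _ (dH t) mM Jx); last first.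
      move=> i iM y Jy; have [_ E] := dotE K t i y tI iM Jy.
      by rewrite /Fm subrK E hornerZ.
    rewrite (dt_eq (F :=
      (fun s : R => 2^-1 * (bil K (at_time G s m) (at_time Q s m)).[x]) : R ->
        R^o) tI); last first.
      by move=> s sI; rewrite /Gm; have [-> _] := dotE K s m x sI mM Jx.
    rewrite (DA K t m x).1 /W (rQ _ (oI _ tI) _ mM _ Jx) (rP _ (oI _ tI) _ mM _ Jx).
    rewrite -/(grad_pair S (Q m) (P m) t x); congr (_ - _).
    by rewrite !(hornerD, hornerN, hornerZ); lra.
  - rewrite integral_ooB; first last.
    + exact: continuous_grad_pair_x.
    + exact: continuous_horner.
    rewrite -[X in X - _]/(pint _ _ _) pintD (localA K K_skew H t m mM (dH t))
      -addrA.
    by rewrite /rho bbilE.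
have [en1 en2] : \int[leb]_(t in telem tm n)
  \int[leb]_(x in `[0, 1[) energy t x = 0 /\
    forall m, (m < nelem xm)%N ->
      \int[leb]_(t in telem tm n) \int[leb]_(x in xelem xm m) energy t x =
    \int[leb]_(t in `]a, b[) skew_flux xm L (at_time U t) (at_time Q t) m.
  have [H dH] := Hex L.
  (* Besides the flux there remains G(Z) . L Z_t + S(Z)_t, which is minus the
     residual tested with Z_t. *)
  pose rho m t := pint (node xm m) (node xm m.+1) (bbil L (G m) (U m)).[t%:P]
    + \int[leb]_(x in xelem xm m) grad_pair S (Q m) (U m) t x.
  have crho m : continuous (rho m).
    move=> t; apply: cvgD; first exact: continuous_pint_bi.
    exact: continuous_int_grad_pair.
  apply: (@laws_of_elem_identity _ _ _ _ _ _ (fun t m x =>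
    (2^-1 *: bil L (at_time GU t m) (at_time Q t m)
      - 2^-1 *: bil L (at_time G t m) (at_time U t m) + H t m +
        bil L (at_time G t m) (at_time U t m)).[x]
      + grad_pair S (Q m) (U m) t x) _ rho); last first.
  - by move=> t; exact: sum_skew_flux.
  - move=> m mM.
    have E t : rho m t =
      -1 * (pint (node xm m) (node xm m.+1) (bbil K (U m) (U m) +
        bbil L (U m) (G m)).[t%:P]
      - \int[leb]_(x in xelem xm m) grad_pair S (Q m) (U m) t x).
      rewrite (bbil_alt _ K_skew) add0r (bbil_skew (U m) (G m) L_skew) hornerN.
      by rewrite raddfN/= /rho; ring.
    under eq_Rintegral do rewrite E.
    rewrite integral_ooZ; last first.
      move=> t; apply: cvgB; first exact: continuous_pint_bi.
      exact: continuous_int_grad_pair.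
    by rewrite (method_residual S_C1 nT mM reps (sU m) method) mulr0.
  - by move=> m _; exact: crho.
  - by move=> m _; exact: continuous_skew_flux.
  move=> t tI m mM; split.
  - move=> x; apply: cvgD; first exact: continuous_horner.
    exact: continuous_grad_pair_x.
  - move=> x Jx; rewrite /energy.
    rewrite (disc_deriv1_pw_poly (w := fun i =>
      2^-1 *: bil L (at_time U t i) (at_time Q t i)) _ (dH t) mM Jx); last first.
      move=> i iM y Jy; have [_ E] := dotE L t i y tI iM Jy.
      by rewrite /Fe E hornerZ.
    pose F1 := (fun s : R =>
      2^-1 * (bil L (at_time G s m) (at_time Q s m)).[x]) : R -> R^o.
    pose F2 := (fun s : R => S (peval (fun d => (Q m d).[s%:P]) x)) : R -> R^o.
    rewrite (dt_eq (F := F1 + F2) tI); last first.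
      move=> s sI; rewrite /Ge; have [-> _] := dotE L s m x sI mM Jx.
      by rewrite (rQ _ (oI _ sI) _ mM _ Jx).
    have [D1 D1d] := DA L t m x; have [D2d D2] := derive_potential S_C1 (Q m) t x.
    rewrite derive1E deriveD// -!derive1E D1 D2.
    rewrite addrAC; congr (_ + _).
    by rewrite !(hornerD, hornerN, hornerZ); lra.
  - rewrite integral_ooD; first last.
    + exact: continuous_grad_pair_x.
    + exact: continuous_horner.
    rewrite -[X in X + _]/(pint _ _ _) pintD (localA L L_skew H t m mM (dH t))
      -addrA.
    by rewrite /rho bbilE.
split => // m mM; rewrite !fluxE//; split; [exact: mom2|exact: en2].
Qed.
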